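(* Let $\boldsymbol\pi=(\boldsymbol\pi_s)_{s\in\mathbb N}$ be a sequence where each $\boldsymbol\pi_s$ is a permutation of $\{0,\dots,2^{m_s}-1\}^d$ acting coordinatewise, i.e. $\boldsymbol\pi_s(\mathbf m)=(\pi^1_s(m^1),\dots,\pi^d_s(m^d))$ for some permutations $\pi^j_s$ of $\{0,\dots,2^{m_s}-1\}$. Let $F^{\boldsymbol\pi}=\bigcap_{s\ge1}F^{\boldsymbol\pi}_s$ be as in the context. Then $F^{\boldsymbol\pi}$ is an $M$-set for the $d$-dimensional Walsh system with respect to convergence by rectangles, by cubes, and repeated convergence for every order of iterated summation; moreover the $d$-fold Walsh series $\sum_{\mathbf n}\widehat{\tau^{\boldsymbol\pi}}_{\mathbf n}W_{\mathbf n}$ generating the quasimeasure $\tau^{\boldsymbol\pi}:=\tau_{F^{\boldsymbol\pi}}$ is a null-series realizing the $M$-set $F^{\boldsymbol\pi}$.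
   Context: Fix an integer $d\ge 2$. $\mathbb G$ is the dyadic group: sequences $g=(g_k)_{k\ge0}$, $g_k\in\{0,1\}$, coordinatewise addition mod 2 ($\oplus$), product topology; $\mathbb G^d$ its $d$-th power, $\mu$ the normalized Haar measure. For $n\in\mathbb N_0$, $n=\sum_kn_k2^k$ with $n_k\in\{0,1\}$. Dyadic interval of rank $k$: $\Delta^{(k)}_m=\{g: g_t=m_{k-1-t},\ 0\le t<k\}$, $0\le m<2^k$; dyadic cube $\Delta^{(k)}_{\mathbf m}=\prod_{l}\Delta^{(k)}_{m^l}$, $\mathbf m\in\{0,\dots,2^k-1\}^d$. Vector order is coordinatewise, $\mathbf 1=(1,\dots,1)$. Walsh functions $W_n(g)=\prod_k(-1)^{g_kn_k}$, $W_{\mathbf n}(\mathbf g)=\prod_lW_{n^l}(g^l)$; for $\mathbf n,\mathbf m<2^k\mathbf 1$, $W^{(k)}_{\mathbf n\mathbf m}$ denotes the constant value of $W_{\mathbf n}$ on $\Delta^{(k)}_{\mathbf m}$; $R_{k\mathbf 1}:=W_{2^k\mathbf 1}$. Series $\sum_{\mathbf n\in\mathbb N_0^d}a_{\mathbf n}W_{\mathbf n}$, partial sums $S_{\mathbf N}=\sum_{\mathbf n<\mathbf N}a_{\mathbf n}W_{\mathbf n}$. Convergence by rectangles: $S_{\mathbf N}(\mathbf g)\to S$ as $\min_jN^j\to\infty$; by cubes: $S_{N\mathbf 1}(\mathbf g)\to S$; repeated convergence for a permutation $(j_1,\dots,j_d)$: the iterated sum $\sum_{n^{j_1}}(\sum_{n^{j_2}}(\cdots\sum_{n^{j_d}}a_{\mathbf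 n}W_{\mathbf n}(\mathbf g)))$ converges to $S$. $A$ is an $M$-set if some series with not all coefficients zero converges to $0$ at every point outside $A$ (a null-series realizing $A$). Quasimeasure: $\tau$ on dyadic cubes with $\tau(\Delta^{(k)}_{\mathbf m})=\sum_{\boldsymbol\sigma\in\{0,1\}^d}\tau(\Delta^{(k+1)}_{2\mathbf m+\boldsymbol\sigma})$; coefficients $\widehat\tau_{\mathbf n}=\sum_{\mathbf m<2^k\mathbf 1}W^{(k)}_{\mathbf n\mathbf m}\tau(\Delta^{(k)}_{\mathbf m})$ ($\mathbf n<2^k\mathbf 1$); $\sum\widehat\tau_{\mathbf n}W_{\mathbf n}$ is the series generating $\tau$. For nonempty closed $E$, $\tau_E$ is the unique nonnegative quasimeasure with $\tau_E(\mathbb G^d)=1$, $\tau_E(\Delta)=0$ iff $\Delta\cap E=\emptyset$, and which splits the value of a cube meeting $E$ equally among those of its $2^d$ children that meet $E$. Let $m_1=0$, $m_{s+1}=2(2m_s+1)$. For $s\in\mathbb N$, $F^{\boldsymbol\pi}_s=\bigcup_{\mathbf m<2^{m_s}\mathbf 1}\bigcup_{\mathbf m'<2^{m_s}\mathbf 1}\{\mathbf g\in\Delta^{(2m_s)}_{2^{m_s}\mathbf m+\mathbf m'}: R_{2m_s\mathbf 1}(\mathbf g)=W^{(m_s)}_{\boldsymbol\pi_s(\mathbf m)\,\mathbf m'}\}$ and $F^{\boldsymbol\pi}=\bigcap_sF^{\boldsymbol\pi}_s$. *)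

(* Defs.v *)
From HB Require Import structures.
From mathcomp Require Import all_boot all_order all_algebra all_fingroup.
From mathcomp Require Import reals.
Set Implicit Arguments. Unset Strict Implicit. Unset Printing Implicit Defensive.
Import Order.TTheory GRing.Theory Num.Theory.
Local Open Scope ring_scope.

Section Walsh.
Variables (R : realType) (d : nat).

(* A point of G is x : nat -> bool (x k = g_k); a point of G^d is 'I_d -> nat -> bool. *)
Definition pt := 'I_d -> nat -> bool.
Definition midx := 'I_d -> nat.

(* one-dimensional Walsh function W_n(g) = prod_k (-1)^(g_k n_k); bits of n vanish for k >= n *)
Definition W1 (n : nat) (x : nat -> bool) : R :=
  (-1) ^+ (\sum_(k < n) ((x k) && odd (n %/ 2 ^ k)))%N.

Definition Wd (n : midx) (g : pt) : R := \prod_(j < d) W1 (n j) (g j).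

(* membership in the dyadic interval Delta^(k)_m : g_t = m_{k-1-t}, 0 <= t < k *)
Definition in_int (k m : nat) (x : nat -> bool) : Prop :=
  forall t, (t < k)%N -> x t = odd (m %/ 2 ^ (k - 1 - t)).
Definition in_cube (k : nat) (m : midx) (g : pt) : Prop :=
  forall l, in_int k (m l) (g l).

Definition rep_pt (k : nat) (m : midx) : pt :=
  fun l t => (t < k)%N && odd (m l %/ 2 ^ (k - 1 - t)).
(* W^(k)_{n m}: the (constant) value of W_n on Delta^(k)_m, for n, m < 2^k 1 *)
Definition Wk (k : nat) (n m : midx) : R := Wd n (rep_pt k m).

Definition Rk (k : nat) : pt -> R := Wd (fun _ => 2 ^ k)%N.

Definition bnd (N : midx) : nat := (\sum_(j < d) N j)%N.

Definition psum (a : midx -> R) (N : midx) (g : pt) : R :=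
  \sum_(n : {ffun 'I_d -> 'I_(bnd N)} | [forall j, (n j < N j)%N])
     a (fun j => nat_of_ord (n j)) * Wd (fun j => nat_of_ord (n j)) g.

Definition conv_rect (a : midx -> R) (g : pt) (S : R) : Prop :=
  forall e : R, 0 < e -> exists K : nat, forall N : midx,
    (forall j, (K <= N j)%N) -> `|psum a N g - S| < e.

Definition conv_cube (a : midx -> R) (g : pt) (S : R) : Prop :=
  forall e : R, 0 < e -> exists K : nat, forall N : nat,
    (K <= N)%N -> `|psum a (fun _ => N) g - S| < e.

Definition series_conv (b : nat -> R) (S : R) : Prop :=
  forall e : R, 0 < e -> exists K : nat, forall M : nat,
    (K <= M)%N -> `|\sum_(m < M) b m - S| < e.

Definition upd (n : midx) (c : 'I_d) (v : nat) : midx :=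
  fun j => if j == c then v else n j.

(* iterated summation of f, summing first (innermost) over the last coordinate
   of the list cs, and last (outermost) over the head of cs; every inner series
   is required to converge. *)
Fixpoint iter_conv (f : midx -> R) (cs : seq 'I_d) (n : midx) (S : R) : Prop :=
  match cs with
  | [::] => S = f n
  | c :: cs' => exists b : nat -> R,
      (forall v, iter_conv f cs' (upd n c v) (b v)) /\ series_conv b S
  end.

Definition conv_rep (sg : {perm 'I_d}) (a : midx -> R) (g : pt) (S : R) : Prop :=
  iter_conv (fun n => a n * Wd n g) [seq sg i | i <- enum 'I_d] (fun _ => 0%N) S.

Definition null_series_for (conv : (midx -> R) -> pt -> R -> Prop)
    (a : midx -> R) (A : pt -> Prop) : Prop :=
  (exists n, a n != 0) /\ forall g, ~ A g -> conv a g 0.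

Definition Mset (conv : (midx -> R) -> pt -> R -> Prop) (A : pt -> Prop) : Prop :=
  exists a : midx -> R, null_series_for conv a A.

(* tau k m is the value on Delta^(k)_m (meaningful for m < 2^k 1) *)
Definition in_range (k : nat) (m : midx) : Prop := forall l, (m l < 2 ^ k)%N.

Definition child (m : midx) (sg : {ffun 'I_d -> bool}) : midx :=
  fun l => (2 * m l + sg l)%N.

Definition quasimeasure (tau : nat -> midx -> R) : Prop :=
  forall k m, in_range k m ->
    tau k m = \sum_(sg : {ffun 'I_d -> bool}) tau k.+1 (child m sg).

(* Fourier-Walsh coefficient, computed at the rank k = sum_j n^j (so n < 2^k 1) *)
Definition tauhat (tau : nat -> midx -> R) (n : midx) : R :=
  let k := (\sum_(j < d) n j)%N in
  \sum_(m : {ffun 'I_d -> 'I_(2 ^ k)})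
     Wk k n (fun l => nat_of_ord (m l)) * tau k (fun l => nat_of_ord (m l)).

Definition meets (k : nat) (m : midx) (E : pt -> Prop) : Prop :=
  exists g, in_cube k m g /\ E g.

Definition is_tauE (E : pt -> Prop) (tau : nat -> midx -> R) : Prop :=
  [/\ quasimeasure tau,
      (forall k m, in_range k m -> 0 <= tau k m),
      tau 0%N (fun _ => 0%N) = 1,
      (forall k m, in_range k m -> (tau k m = 0 <-> ~ meets k m E)) &
      (forall k m, in_range k m -> meets k m E ->
         forall sg sg', meets k.+1 (child m sg) E -> meets k.+1 (child m sg') E ->
           tau k.+1 (child m sg) = tau k.+1 (child m sg'))].

(* msq t = m_{t+1}:  m_1 = 0, m_{s+1} = 2(2 m_s + 1) *)
Fixpoint msq (t : nat) : nat :=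
  match t with 0 => 0 | t'.+1 => 2 * (2 * msq t' + 1) end%N.

(* pis t j = pi^j_{t+1}, a permutation of {0,...,2^{m_{t+1}}-1} *)
Definition Fs (pis : forall t : nat, 'I_d -> {perm 'I_(2 ^ msq t)}) (t : nat) (g : pt) : Prop :=
  let ms := msq t in
  exists m m' : {ffun 'I_d -> 'I_(2 ^ ms)},
    in_cube (2 * ms) (fun l => 2 ^ ms * m l + m' l)%N g /\
    Rk (2 * ms) g = Wk ms (fun l => nat_of_ord (pis t l (m l))) (fun l => nat_of_ord (m' l)).

Definition Fpi (pis : forall t : nat, 'I_d -> {perm 'I_(2 ^ msq t)}) (g : pt) : Prop :=
  forall t, Fs pis t g.

End Walsh.

(* Main.v *)
(* Let R_i be the product over the d coordinates of the i-th Rademacher functions.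
   Membership in F^pi says 1 + R_i(g) q_i(g) <> 0 for all i, where q_i(g) = 0
   unless i = 2 m_s, and q_{2 m_s}(g) = W_{pi_s(m)}(m') = +-1 depends only on the
   first 2 m_s bits of g. Hence the density of tau^pi at rank k is the Riesz-type
   product X_k = prod_{i<k} (1 + R_i q_i), and its Walsh coefficients vanish
   unless all n^l lie in a common dyadic block [2^i, 2^(i+1)) with i = 2 m_s (or
   n = 0).

   Let g lie outside F^pi, say with factor number k0 - 1 vanishing at g, and let
   min N lie in [2^i, 2^(i+1)). Then S_N(g) = 0 unless i = 2m with m = m_s. In that
   case, integrating out the bits m, ..., 2m-1 against q_{2m} leaves an average
   over x of X_m(x) times a product of Dirichlet kernels D_{K_l} at the dyadic sum
   of g^l and x^l, where K_l = min(2^m, N'^l - 2^m pi_s(x^l)) and N'^l = min(N^l,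
   2^(i+1)) - 2^i. For each l these kernels are nonzero for at most two values of
   x^l, and in some coordinate x differs from g among the first k0 bits, which
   bounds that kernel by 2^k0 instead of 2^m. So S_N(g) is O(2^s 2^-m_s), which
   tends to 0. Because of the block structure, the partial sums of any iterated
   series are rectangular partial sums. *)
Require Import Defs.
From mathcomp Require Import all_boot all_order all_algebra all_fingroup.
From mathcomp Require Import boolp reals.
From mathcomp Require Import zify ring lra.
Import Order.TTheory GRing.Theory Num.Theory.
Set Implicit Arguments. Unset Strict Implicit. Unset Printing Implicit Defensive.
Local Open Scope ring_scope.

(** * Binary digits of indices and concatenation of points *)

Definition catp (k : nat) (x y : nat -> bool) : nat -> bool :=
  fun t => if (t < k)%N then x t else y (t - k)%N.

Definition rep1 (k m : nat) : nat -> bool :=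
  fun t => (t < k)%N && odd (m %/ 2 ^ (k - 1 - t)).

Lemma odd_divn_addM (b e m r : nat) : (e < b)%N ->
  odd ((2 ^ b * m + r) %/ 2 ^ e) = odd (r %/ 2 ^ e).
Proof.
move=> eb; have -> : (2 ^ b * m = 2 ^ (b - e).-1.+1 * m * 2 ^ e)%N.
  by rewrite -mulnA (mulnC m) mulnA -expnD; congr (2 ^ _ * _)%N; lia.
by rewrite divnMDl ?expn_gt0 // oddD expnS -mulnA oddM.
Qed.

(** Indices list the digits of a point with the most significant bit first, so the low-order part
    [m'] supplies the digits that come last. *)
Lemma rep1_cat (a b m m' : nat) : (m' < 2 ^ b)%N ->
  rep1 (a + b) (2 ^ b * m + m') = catp a (rep1 a m) (rep1 b m').
Proof.
move=> hm'; apply/funext => t; rewrite /rep1 /catp; case: (ltnP t a) => ta.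
  rewrite ltn_addr //=; have -> : (a + b - 1 - t = b + (a - 1 - t))%N by lia.
  by rewrite expnD divnMA mulnC divnMDl ?expn_gt0 // (divn_small hm') addn0.
have -> : (t < a + b)%N = (t - a < b)%N by lia.
case: (ltnP (t - a) b) => //= tb.
have -> : (a + b - 1 - t = b - 1 - (t - a))%N by lia.
by rewrite odd_divn_addM //; lia.
Qed.

Lemma catp_shift (k : nat) (x : nat -> bool) :
  catp k x (fun t => x (k + t)%N) = x.
Proof.
apply/funext => t; rewrite /catp; case: ltnP => // kt; by rewrite subnKC.
Qed.

Lemma catp_low (k : nat) (x y : nat -> bool) t : (t < k)%N -> catp k x y t = x t.
Proof. by rewrite /catp => ->. Qed.

Lemma catp_high (k : nat) (x y : nat -> bool) t : catp k x y (k + t)%N = y t.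
Proof. by rewrite /catp ltnNge leq_addr /= addKn. Qed.

(** Inverse of [rep1 k], with digit 0 of the point as the most significant bit. *)
Fixpoint num (k : nat) (x : nat -> bool) : nat :=
  if k is k'.+1 then (2 * num k' x + x k')%N else 0%N.

Lemma num_lt k x : (num k x < 2 ^ k)%N.
Proof.
elim: k => //= k IH; rewrite expnS; case: (x k); lia.
Qed.

Lemma rep1_num k x t : (t < k)%N -> rep1 k (num k x) t = x t.
Proof.
elim: k t => // k IH t; rewrite ltnS => tk.
rewrite /= -[X in rep1 X]addn1 (_ : 2 * num k x = 2 ^ 1 * num k x)%N //.
rewrite rep1_cat; last by case: (x k).
rewrite /catp; case: ltnP => kt; first exact: IH.
have -> : t = k by lia.
by rewrite subnn /rep1 /= divn1; case: (x k).
Qed.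

Lemma num_rep1 k m : (m < 2 ^ k)%N -> num k (rep1 k m) = m.
Proof.
elim: k m => [[]//|k IH] m hm /=.
have e : rep1 k.+1 m = catp k (rep1 k (m %/ 2)) (rep1 1 (odd m)).
  rewrite -rep1_cat; last by case: (odd m).
  rewrite addn1 expn1; congr rep1; by rewrite {1}(divn_eq m 2) mulnC modn2.
have numE x y j : (j <= k)%N -> num j (catp k x y) = num j x.
  elim: j => //= j IHj jk; rewrite IHj 1?ltnW //; by rewrite catp_low.
rewrite e numE // /catp ltnn subnn IH; last first.
  by rewrite ltn_divLR // mulnC -expnS.
by rewrite /rep1 /= divn1 oddb -modn2 mulnC -divn_eq.
Qed.

Lemma num_ext k x y : (forall t, (t < k)%N -> x t = y t) -> num k x = num k y.
Proof.
elim: k => //= k IH h; rewrite (h k) // IH // => t tk; apply: h; exact: ltnW.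
Qed.

(** * Walsh functions and Dirichlet kernels in one variable *)

Section Walsh1.
Variable R : realType.
Implicit Types x y : nat -> bool.

(** Positions beyond the binary length of [n] contribute factors 1, so the range of [n] positions in
    [W1] can be traded for any range containing the bits of [n]. *)
Lemma W1E K n x : (n < 2 ^ K)%N ->
  W1 R n x = \prod_(k < K) (-1) ^+ (x k && odd (n %/ 2 ^ k)).
Proof.
move=> nK; rewrite /W1 expr_sum.
have small a b : (a <= b)%N -> (n < 2 ^ a)%N ->
    \prod_(k < b) (-1) ^+ (x k && odd (n %/ 2 ^ k)) =
    \prod_(k < a) (-1) ^+ (x k && odd (n %/ 2 ^ k)) :> R.
  move=> ab na.
  rewrite -(big_mkord xpredT (fun k => (-1) ^+ (x k && odd (n %/ 2 ^ k)))).
  rewrite (big_cat_nat (n := a)) //= big_mkord.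
  rewrite [X in _ * X]big_nat_cond [X in _ * X]big1 ?mulr1 // => i.
  rewrite andbT => /andP[ai _]; rewrite divn_small ?andbF //.
  by apply: leq_trans na _; rewrite leq_exp2l.
by case: (leqP n K) => h; [rewrite (small _ _ h) // ltn_expl | rewrite (small K n) // ltnW].
Qed.

(** Walsh functions pair digit [t] of the point with the bit of weight [2 ^ t], opposite to the
    order in [rep1]; hence the remainder of [n] goes with the head and the quotient with the
    tail. *)
Lemma W1_cat n k x y :
  W1 R n (catp k x y) = W1 R (n %% 2 ^ k) x * W1 R (n %/ 2 ^ k) y.
Proof.
rewrite (@W1E (k + n)); last first.
  by apply: leq_trans (ltn_expl n (ltnSn 1)) _; rewrite leq_exp2l // leq_addl.
rewrite big_split_ord (@W1E k (n %% _)) ?ltn_mod ?expn_gt0 //.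
rewrite (@W1E n (n %/ _)); last by apply: leq_ltn_trans (leq_div _ _) (ltn_expl n _).
congr (_ * _); apply: eq_bigr => i _ /=.
  rewrite catp_low // {1}(divn_eq n (2 ^ k)) mulnC odd_divn_addM //.
by rewrite catp_high expnD divnMA.
Qed.

Lemma W1_0 x : W1 R 0 x = 1.
Proof. by rewrite /W1 big_ord0. Qed.

Lemma W1_1 x : W1 R 1 x = (-1) ^+ x 0%N.
Proof. by rewrite /W1 big_ord1 /= andbT. Qed.

Lemma W1_norm n x : `|W1 R n x| = 1.
Proof. by rewrite /W1 normrX normrN1 expr1n. Qed.

Lemma W1_shift n k x :
  W1 R n x = W1 R (n %% 2 ^ k) x * W1 R (n %/ 2 ^ k) (fun t => x (k + t)%N).
Proof. by rewrite -{1}(catp_shift k x) W1_cat. Qed.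

Lemma W1_pow2 k x : W1 R (2 ^ k) x = (-1) ^+ x k.
Proof.
by rewrite (W1_shift _ k) modnn W1_0 mul1r divnn expn_gt0 W1_1 addn0.
Qed.

(** Isolates the digit of rank [k] in the affine form that [avg_rieszS] integrates. *)
Lemma W1_split k n x y : (n < 2 ^ k.+1)%N ->
  W1 R n (catp k x y) = (if (n < 2 ^ k)%N then W1 R n x else 0) +
    (-1) ^+ y 0%N * (if (n < 2 ^ k)%N then 0 else W1 R (n - 2 ^ k) x).
Proof.
move=> hn; rewrite W1_cat; case: ltnP => h.
  by rewrite modn_small // divn_small // W1_0 mulr1 mulr0 addr0.
have e : (n = 1 * 2 ^ k + (n - 2 ^ k))%N by lia.
have h' : (n - 2 ^ k < 2 ^ k)%N by rewrite expnS in hn; lia.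
by rewrite {1 2}e modnMDl modn_small // divnMDl ?expn_gt0 // divn_small // W1_1 add0r mulrC.
Qed.

Lemma W1_ext n k x y : (n < 2 ^ k)%N -> (forall t, (t < k)%N -> x t = y t) ->
  W1 R n x = W1 R n y.
Proof. by move=> nk h; rewrite !(W1E _ nk); apply: eq_bigr => i _; rewrite h. Qed.

Lemma sum_ord_mul q r (G : nat -> R) :
  \sum_(p < q * r) G p = \sum_(i < q) \sum_(j < r) G (r * i + j)%N.
Proof.
elim: q => [|q IH]; first by rewrite mul0n !big_ord0.
rewrite mulSnr big_split_ord /= IH big_ord_recr /=; congr (_ + _).
by apply: eq_bigr => j _; rewrite mulnC.
Qed.

(** Induction on the rank: the last digit of the point, the parity of [p], pairs with the top bits
    of [c] and [n], and the two-term sum over it detects whether these agree. *)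
Lemma W1_orth k c n : (c < 2 ^ k)%N -> (n < 2 ^ k)%N ->
  \sum_(p < 2 ^ k) W1 R c (rep1 k p) * W1 R n (rep1 k p) =
  (2 ^ k)%:R * (c == n)%:R.
Proof.
elim: k c n => [[] // [] // _ _|k IH c n hc hn].
  by rewrite big_ord1 !W1_0 !mulr1.
have hq a : (a < 2 ^ k.+1)%N -> (a %/ 2 ^ k < 2)%N.
  by move=> ha; rewrite ltn_divLR ?expn_gt0 // -expnS.
have := sum_ord_mul (2 ^ k) 2 (fun p => W1 R c (rep1 k.+1 p) * W1 R n (rep1 k.+1 p)).
rewrite -expnSr => ->.
have step (i : nat) : \sum_(j < 2) W1 R c (rep1 k.+1 (2 * i + j)) * W1 R n (rep1 k.+1 (2 * i + j)) =
    W1 R (c %% 2 ^ k) (rep1 k i) * W1 R (n %% 2 ^ k) (rep1 k i) *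
    (2 * (c %/ 2 ^ k == n %/ 2 ^ k)%N%:R).
  transitivity (W1 R (c %% 2 ^ k) (rep1 k i) * W1 R (n %% 2 ^ k) (rep1 k i) *
    \sum_(j < 2) W1 R (c %/ 2 ^ k) (rep1 1 j) * W1 R (n %/ 2 ^ k) (rep1 1 j)).
    rewrite mulr_sumr; apply: eq_bigr => j _.
    by rewrite -(addn1 k) (@rep1_cat k 1 i j) // !W1_cat; ring.
  congr (_ * _); rewrite !big_ord_recl big_ord0 /=.
  move: (hq _ hc) (hq _ hn).
  by case: (c %/ _)%N => [|[|]] //; case: (n %/ _)%N => [|[|]] // _ _;
    rewrite ?W1_0 ?W1_1 /rep1 /=; ring.
under eq_bigr do rewrite step.
rewrite -mulr_suml IH ?ltn_mod ?expn_gt0 //.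
have -> : (c == n) = (c %% 2 ^ k == n %% 2 ^ k)%N && (c %/ 2 ^ k == n %/ 2 ^ k)%N.
  apply/eqP/andP => [->//|[/eqP e1 /eqP e2]].
  by rewrite (divn_eq c (2 ^ k)) (divn_eq n (2 ^ k)) e1 e2.
by rewrite expnS natrM; case: (_ == _); case: (_ == _); rewrite /=; ring.
Qed.

(** The indices with quotient [c] form one run of length [M] starting at [M * c] and cut off at [N];
    truncated subtraction covers the empty run. *)
Lemma sum_divn_eq N M c (F : nat -> R) : (0 < M)%N ->
  \sum_(n < N | (n %/ M == c)%N) F n =
  \sum_(i < minn M (N - M * c)) F (M * c + i)%N.
Proof.
move=> M0; elim: N => [|N IH]; first by rewrite sub0n minn0 !big_ord0.
rewrite big_mkcond big_ord_recr /= -big_mkcond /= IH.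
case: (eqVneq (N %/ M)%N c) => [e|/eqP ne].
  have h1 : (M * c <= N)%N by rewrite -e mulnC leq_trunc_div.
  have h2 : (N - M * c < M)%N by rewrite -e {1}(divn_eq N M) mulnC addKn ltn_mod.
  have -> : minn M (N - M * c) = (N - M * c)%N by lia.
  have -> : minn M (N.+1 - M * c) = (N - M * c).+1 by lia.
  by rewrite big_ord_recr /= subnKC.
rewrite addr0; suff -> : minn M (N.+1 - M * c) = minn M (N - M * c) by [].
case: (leqP (M * c) N) => h; last by lia.
suff : (M <= N - M * c)%N by lia.
rewrite leqNgt; apply/negP => h2; apply: ne.
by rewrite -(subnKC h) (mulnC M c) divnMDl // divn_small 1?mulnC // addn0.
Qed.

(* Walsh-Dirichlet kernel D_N at the dyadic sum of x and y. *)
Definition dker (N : nat) x y : R := \sum_(n < N) W1 R n x * W1 R n y.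

(** Along a run of at most [2 ^ k] frequencies starting at [2 ^ k * q] the high bits stay equal to
    [q], so their Walsh factors leave the sum. *)
Lemma dker_block k q r x y : (r <= 2 ^ k)%N ->
  dker (2 ^ k * q + r) x y = dker (2 ^ k * q) x y +
  W1 R q (fun t => x (k + t)%N) * W1 R q (fun t => y (k + t)%N) * dker r x y.
Proof.
move=> rk; rewrite /dker big_split_ord /=; congr (_ + _).
rewrite mulr_sumr; apply: eq_bigr => i _.
have ik : (i < 2 ^ k)%N by apply: leq_trans (ltn_ord i) rk.
rewrite (W1_shift _ k x) (W1_shift _ k y) mulnC modnMDl modn_small //.
rewrite divnMDl ?expn_gt0 // (divn_small ik) addn0; ring.
Qed.

Lemma dker_mul_pow2 k q x y :
  dker (2 ^ k * q) x y = dker (2 ^ k) x y *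
    dker q (fun t => x (k + t)%N) (fun t => y (k + t)%N).
Proof.
elim: q => [|q IH]; first by rewrite muln0 /dker !big_ord0 mulr0.
rewrite mulnSr dker_block // IH [dker q.+1 _ _]/dker big_ord_recr /= -/(dker _ _ _).
ring.
Qed.

Lemma dker_pow2S k x y :
  dker (2 ^ k.+1) x y = dker (2 ^ k) x y * (1 + (-1) ^+ x k * (-1) ^+ y k).
Proof.
rewrite expnSr dker_mul_pow2 /dker !big_ord_recl big_ord0 !W1_0 !W1_1.
by rewrite mulr1 addr0 !addn0.
Qed.

(** The kernel of order [2 ^ k] is a product over the digits below [k]; a digit where the points
    differ makes its factor vanish. *)
Lemma dker_pow2_neq k x y t : (t < k)%N -> x t != y t -> dker (2 ^ k) x y = 0.
Proof.
elim: k => // k IH; rewrite ltnS leq_eqVlt dker_pow2S => /orP[/eqP->|tk ne].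
  by case: (x k) (y k) => [] [] // _; rewrite ?expr1 ?expr0 ?mulr1 ?mul1r subrr mulr0.
by rewrite IH ?mul0r.
Qed.

Lemma dker_norm N x y : `|dker N x y| <= N%:R.
Proof.
apply: le_trans (ler_norm_sum _ _ _) _.
under eq_bigr do rewrite normrM !W1_norm mulr1.
by rewrite sumr_const card_ord.
Qed.

(* The sums of D_N over full blocks of length 2^k cancel. *)
Lemma dker_norm_neq N k x y t : (t < k)%N -> x t != y t ->
  `|dker N x y| <= (2 ^ k)%:R.
Proof.
move=> tk ne; rewrite (divn_eq N (2 ^ k)) mulnC.
have rk : (N %% 2 ^ k < 2 ^ k)%N by rewrite ltn_mod expn_gt0.
rewrite dker_block 1?ltnW // dker_mul_pow2 (dker_pow2_neq tk ne) mul0r add0r.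
rewrite !normrM !W1_norm !mul1r; apply: le_trans (dker_norm _ _ _) _.
by rewrite ler_nat ltnW.
Qed.

(** By orthogonality, integrating the digits [m, ..., 2m-1] against [W_c] keeps exactly the
    frequencies whose quotient by [2 ^ m] is [c]. They form a run cut off at [N], which leaves a
    shorter kernel in the first [m] digits. *)
Lemma avg_W1_dker m c N g x : (c < 2 ^ m)%N -> (N <= 2 ^ (m + m))%N ->
  \sum_(p < 2 ^ m) W1 R c (rep1 m p) * dker N g (catp m x (rep1 m p)) =
  (2 ^ m)%:R * W1 R c (fun t => g (m + t)%N) *
    dker (minn (2 ^ m) (N - 2 ^ m * c)) g x.
Proof.
move=> hc hN; rewrite /dker.
under eq_bigr do rewrite mulr_sumr.
rewrite exchange_big /=.
transitivity (\sum_(n < N | (n %/ 2 ^ m)%N == c)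
    (2 ^ m)%:R * (W1 R n g * W1 R (n %% 2 ^ m) x)).
  rewrite [RHS]big_mkcond; apply: eq_bigr => n _.
  have hn : (n %/ 2 ^ m < 2 ^ m)%N.
    by rewrite ltn_divLR ?expn_gt0 // -expnD; apply: leq_trans (ltn_ord n) hN.
  transitivity (W1 R n g * W1 R (n %% 2 ^ m) x * \sum_(p < 2 ^ m)
     W1 R c (rep1 m p) * W1 R (n %/ 2 ^ m) (rep1 m p)).
    by rewrite mulr_sumr; apply: eq_bigr => p _; rewrite W1_cat; ring.
  by rewrite W1_orth // eq_sym; case: eqP => _; rewrite ?mulr1 ?mulr0 // mulrC.
rewrite (@sum_divn_eq N _ c (fun n => (2 ^ m)%:R * (W1 R n g * W1 R (n %% 2 ^ m) x))) ?expn_gt0 //.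
rewrite mulr_sumr; apply: eq_bigr => i _.
have im : (i < 2 ^ m)%N by apply: leq_trans (ltn_ord i) (geq_minl _ _).
move: (nat_of_ord i) im => {}i im.
rewrite (W1_shift _ m g) mulnC modnMDl modn_small // divnMDl ?expn_gt0 //.
rewrite (divn_small im) addn0; ring.
Qed.
End Walsh1.

(** * Averages over the dyadic cubes of a given rank *)

Section CubeAverage.
Variables (R : realType) (d : nat).
Implicit Types (G : pt d -> R) (x y g : pt d).

Definition catd k x y : pt d := fun l => catp k (x l) (y l).

(** The Haar measure of a dyadic cube of rank [k]. *)
Definition vol k : R := (2 ^ (d * k))%:R^-1.

(** The Haar integral of [G] whenever [G] depends only on the first [k] digits. *)
Definition avg k G : R :=
  vol k * \sum_(m : {ffun 'I_d -> 'I_(2 ^ k)}) G (rep_pt k (fun l => m l)).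

Lemma vol_gt0 k : 0 < vol k.
Proof. by rewrite invr_gt0 ltr0n expn_gt0. Qed.

Lemma volD a b : vol (a + b) = vol a * vol b.
Proof. by rewrite /vol mulnDr expnD natrM invfM. Qed.

Lemma eq_avg k G G' : G =1 G' -> avg k G = avg k G'.
Proof. by move=> e; congr (_ * _); apply: eq_bigr => m _. Qed.

Lemma rep_pt_cat a b (m m' : midx d) : in_range b m' ->
  rep_pt (a + b) (fun l => 2 ^ b * m l + m' l)%N = catd a (rep_pt a m) (rep_pt b m').
Proof. by move=> h; apply/funext => l; apply: rep1_cat. Qed.

(** Fubini for head and tail digits: Euclidean division by [2 ^ b] matches indices of rank [a + b]
    with pairs of indices. *)
Lemma avgD a b G : avg (a + b) G = avg a (fun x => avg b (fun y => G (catd a x y))).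
Proof.
rewrite /avg volD -mulrA; congr (_ * _); rewrite -mulr_sumr; congr (_ * _).
rewrite pair_big /=.
have lt (i : 'I_(2 ^ a)) (j : 'I_(2 ^ b)) : (2 ^ b * i + j < 2 ^ (a + b))%N.
  rewrite expnD; apply: (@leq_trans (2 ^ b * i.+1)).
    by rewrite mulnS addnC ltn_add2r.
  by rewrite mulnC leq_mul2r ltn_ord orbT.
have hi_lt (i : 'I_(2 ^ (a + b))) : (i %/ 2 ^ b < 2 ^ a)%N.
  by rewrite ltn_divLR ?expn_gt0 // -expnD.
have lo_lt (i : 'I_(2 ^ (a + b))) : (i %% 2 ^ b < 2 ^ b)%N.
  by rewrite ltn_mod expn_gt0.
pose f (p : {ffun 'I_d -> 'I_(2 ^ a)} * {ffun 'I_d -> 'I_(2 ^ b)}) :=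
  [ffun l => Ordinal (lt (p.1 l) (p.2 l))] : {ffun 'I_d -> 'I_(2 ^ (a + b))}.
pose f' (m : {ffun 'I_d -> 'I_(2 ^ (a + b))}) :=
  ([ffun l => Ordinal (hi_lt (m l))], [ffun l => Ordinal (lo_lt (m l))])
  : {ffun 'I_d -> 'I_(2 ^ a)} * {ffun 'I_d -> 'I_(2 ^ b)}.
rewrite (reindex f) /=; last first.
  exists f' => [[p1 p2] _|m _].
    congr pair; apply/ffunP => l; apply/val_inj; rewrite !ffunE /= mulnC.
      by rewrite divnMDl ?expn_gt0 // (divn_small (ltn_ord _)) addn0.
    by rewrite modnMDl modn_small.
  by apply/ffunP => l; apply/val_inj; rewrite !ffunE /= mulnC -divn_eq.
apply: eq_bigr => -[p1 p2] _ /=; congr G.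
rewrite -rep_pt_cat; last by move=> l.
by congr rep_pt; apply/funext => l; rewrite ffunE.
Qed.

Lemma avg_prod k (phi : 'I_d -> (nat -> bool) -> R) :
  avg k (fun x => \prod_l phi l (x l)) =
  \prod_l ((2 ^ k)%:R^-1 * \sum_(p < 2 ^ k) phi l (rep1 k p)).
Proof.
rewrite big_split /= prodr_const card_ord exprVn -natrX -expnM mulnC; congr (_ * _).
by rewrite bigA_distr_bigA.
Qed.

Lemma avgM k c G : avg k (fun x => c * G x) = c * avg k G.
Proof. by rewrite /avg -mulr_sumr mulrCA. Qed.

Lemma avgDr k G G' : avg k (fun x => G x + G' x) = avg k G + avg k G'.
Proof. by rewrite /avg big_split /= mulrDr. Qed.

Lemma le_avg k G G' : (forall x, G x <= G' x) -> avg k G <= avg k G'.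
Proof. by move=> h; rewrite ler_wpM2l ?ler_sum // ltW // vol_gt0. Qed.

Lemma avg_norm k G : `|avg k G| <= avg k (fun x => `|G x|).
Proof. by rewrite normrM gtr0_norm ?vol_gt0 // ler_wpM2l ?ler_norm_sum // ltW // vol_gt0. Qed.

Lemma avg_sum k (I : finType) (P : pred I) (G : I -> pt d -> R) :
  avg k (fun x => \sum_(i | P i) G i x) = \sum_(i | P i) avg k (G i).
Proof. by rewrite /avg exchange_big /= mulr_sumr. Qed.

(** In each coordinate the term carrying the sign averages to 0. *)
Lemma avg1_prod (A B : 'I_d -> R) :
  avg 1 (fun y => \prod_l (A l + (-1) ^+ y l 0%N * B l)) = \prod_l A l.
Proof.
rewrite (avg_prod 1 (fun l z => A l + (-1) ^+ z 0%N * B l)).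
apply: eq_bigr => l _; rewrite !big_ord_recl big_ord0 /rep1 /= expn1; lra.
Qed.

End CubeAverage.

(** * Riesz products and the quasimeasures they generate *)

Section Riesz.
Variables (R : realType) (d : nat) (q : nat -> pt d -> R).
Hypothesis d_gt0 : (0 < d)%N.
Hypothesis q_local : forall i (g g' : pt d),
  (forall l t, (t < i)%N -> g l t = g' l t) -> q i g = q i g'.
Hypothesis q_val : forall i g, [\/ q i g = 0, q i g = 1 | q i g = -1].
Implicit Types (x y g : pt d) (tau : nat -> midx d -> R).

Definition riesz k g : R := \prod_(i < k) (1 + Rk R i g * q i g).

Definition riesz_set g : Prop := forall i, 1 + Rk R i g * q i g != 0.

(** Volume times density; under [q_local] the density is constant on cubes of rank [k]. *)
Definition riesz_tau k (m : midx d) : R := vol R d k * riesz k (rep_pt k m).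

Lemma RkE k g : Rk R k g = \prod_l (-1) ^+ g l k.
Proof. by apply: eq_bigr => l _; rewrite W1_pow2. Qed.

Lemma Rk_val k g : Rk R k g = 1 \/ Rk R k g = -1.
Proof.
rewrite RkE; elim/big_ind: _ => [|a b|l _]; first by left.
  by case=> -> [] ->; rewrite ?mulrNN ?mulr1 ?mul1r; auto.
by case: (g l k); rewrite ?expr0 ?expr1; auto.
Qed.

Lemma factor_local i g g' : (forall l t, (t <= i)%N -> g l t = g' l t) ->
  1 + Rk R i g * q i g = 1 + Rk R i g' * q i g'.
Proof.
move=> h; rewrite (q_local (g' := g')); last by move=> l t /ltnW; apply: h.
by rewrite !RkE; congr (_ + _ * _); apply: eq_bigr => l _; rewrite h.
Qed.

Lemma riesz_local k g g' : (forall l t, (t < k)%N -> g l t = g' l t) ->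
  riesz k g = riesz k g'.
Proof.
move=> h; apply: eq_bigr => i _; apply: factor_local => l t ti; apply: h.
exact: leq_ltn_trans ti (ltn_ord i).
Qed.

Lemma factor_ge0 i g : 0 <= 1 + Rk R i g * q i g.
Proof. by case: (Rk_val i g) => ->; case: (q_val i g) => ->; lra. Qed.

Lemma riesz_ge0 k g : 0 <= riesz k g.
Proof. by apply: prodr_ge0 => i _; apply: factor_ge0. Qed.

Lemma rieszS k g : riesz k.+1 g = riesz k g * (1 + Rk R k g * q k g).
Proof. by rewrite /riesz big_ord_recr. Qed.

Lemma riesz_cat k x y :
  riesz k.+1 (catd k x y) = riesz k x * (1 + q k x * \prod_l (-1) ^+ y l 0%N).
Proof.
rewrite rieszS; congr (_ * _).
  by apply: riesz_local => l t tk; rewrite /catd catp_low.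
rewrite (q_local (g' := x)) => [|l t tk]; last by rewrite /catd catp_low.
rewrite mulrC RkE; congr (_ + _ * _); apply: eq_bigr => l _.
by rewrite /catd -{2}(addn0 k) catp_high.
Qed.

Lemma riesz_eq0 i k g : (i < k)%N -> 1 + Rk R i g * q i g = 0 -> riesz k g = 0.
Proof. by move=> ik e; rewrite /riesz (bigD1 (Ordinal ik)) //= e mul0r. Qed.

(* Integrating out the bits of rank k: by orthogonality of the signs only the
   products of all the A's and of all the B's survive. *)
Lemma avg_rieszS k (phi A B : 'I_d -> (nat -> bool) -> R) :
  (forall l (x y : nat -> bool), phi l (catp k x y) = A l x + (-1) ^+ y 0%N * B l x) ->
  avg k.+1 (fun x => riesz k.+1 x * \prod_l phi l (x l)) =
  avg k (fun x => riesz k x * (\prod_l A l (x l) + q k x * \prod_l B l (x l))).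
Proof.
move=> hphi; rewrite -addn1 avgD; apply: eq_avg => x; rewrite addn1.
(* Multiplying a factor by its sign interchanges [A l] and [B l], so the term with [q k x] takes the
   shape required by [avg1_prod]. *)
transitivity (avg 1 (fun y => riesz k x * \prod_l (A l (x l) + (-1) ^+ y l 0%N * B l (x l))
   + riesz k x * q k x * \prod_l (B l (x l) + (-1) ^+ y l 0%N * A l (x l)))).
  apply: eq_avg => y; rewrite riesz_cat mulrDr mulr1 mulrDl; congr (_ * _ + _).
    by apply: eq_bigr => l _; apply: hphi.
  rewrite mulrA -!mulrA; do 2 congr (_ * _); rewrite -big_split /=.
  apply: eq_bigr => l _; rewrite hphi mulrDr addrC mulrA.
  by rewrite -expr2 sqrr_sign mul1r.
by rewrite avgDr !avgM !avg1_prod mulrDr mulrA.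
Qed.

Section Extension.
Variables (l0 : 'I_d) (k : nat) (g : pt d).

Definition fix_bit i (h : pt d) : pt d := fun l t =>
  if (1 + Rk R i h * q i h == 0) && (l == l0) && (t == i) then ~~ h l t else h l t.

Fixpoint fixes n : pt d := if n is n'.+1 then fix_bit (k + n') (fixes n') else g.

(** Limit of the stages [fixes n]: stage [n.+1] may change only digit [k + n], so digit [t] is final
    at stage [t.+1]. *)
Definition extension : pt d := fun l t => fixes t.+1 l t.

(** Flipping digit [i] in the single coordinate [l0] negates [R_i] and leaves [q_i] unchanged, which
    turns a factor 0 into 2. *)
Lemma fix_bit_neq0 i h : 1 + Rk R i (fix_bit i h) * q i (fix_bit i h) != 0.
Proof.
rewrite (q_local (g' := h)) => [|l t ti]; last by rewrite /fix_bit (ltn_eqF ti) andbF.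
case: (eqVneq (1 + Rk R i h * q i h) 0) => [e|ne].
  have -> : Rk R i (fix_bit i h) = - Rk R i h.
    rewrite !RkE [in LHS](bigD1 l0) // [in RHS](bigD1 l0) //=.
    rewrite /fix_bit e !eqxx /= -mulNr; congr (_ * _).
      by case: (h l0 i); rewrite ?expr1 ?expr0 ?opprK.
    by apply: eq_bigr => l /negbTE ->.
  move/eqP: e; rewrite addrC addr_eq0 => /eqP e.
  by rewrite mulNr e opprK (_ : 1 + 1 = 2%:R) // pnatr_eq0.
suff -> : fix_bit i h = h by [].
by apply/funext => l; apply/funext => t; rewrite /fix_bit (negbTE ne).
Qed.

Lemma fixes_stable n n' l t : (t < k + n)%N -> (n <= n')%N ->
  fixes n' l t = fixes n l t.
Proof.
move=> tk; elim: n' => [|n' IH]; first by rewrite leqn0 => /eqP ->.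
rewrite leq_eqVlt => /orP[/eqP -> //|nn'] /=; rewrite -IH //.
by rewrite /fix_bit ltn_eqF ?andbF //; lia.
Qed.

Lemma extensionE n l t : (t < k + n)%N -> extension l t = fixes n l t.
Proof.
move=> tn; rewrite /extension; case: (leqP n t.+1) => h; first by rewrite (fixes_stable _ tn).
by rewrite -(@fixes_stable t.+1 n) //; lia.
Qed.

Lemma extension_riesz : riesz k g != 0 -> riesz_set extension.
Proof.
move=> ne i; case: (ltnP i k) => ik.
  rewrite (factor_local (g' := g)) => [|l t ti].
    by apply: contraNneq ne => /(riesz_eq0 ik) ->.
  by rewrite (@extensionE 0) // addn0; apply: leq_ltn_trans ti ik.
rewrite -(subnKC ik) (factor_local (g' := fixes (i - k).+1)) => [|l t ti].
  exact: fix_bit_neq0.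
by rewrite (@extensionE (i - k).+1) //; lia.
Qed.

End Extension.

Lemma in_cubeP k m g : in_cube k m g <-> forall l t, (t < k)%N -> g l t = rep_pt k m l t.
Proof. by split=> h l t tk; rewrite (h l t tk) /rep_pt tk. Qed.

(** Conversely to the obvious direction, a cube of nonzero density contains the point obtained by
    repairing the later factors one digit at a time. *)
Lemma meets_rieszP k m : meets k m riesz_set <-> riesz k (rep_pt k m) <> 0.
Proof.
split=> [[g [/in_cubeP hg Fg]]|/eqP ne].
  rewrite -(riesz_local hg); apply/eqP/prodf_neq0 => i _; exact: Fg.
exists (extension (Ordinal d_gt0) k (rep_pt k m)); split; last exact: extension_riesz.
by apply/in_cubeP => l t tk; rewrite (@extensionE _ _ _ 0) // addn0.
Qed.

(** The value of [R_k] on the child [sg] of a cube of rank [k]. *)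
Definition sgn (sg : {ffun 'I_d -> bool}) : R := \prod_l (-1) ^+ sg l.

Lemma riesz_child k m sg : riesz k.+1 (rep_pt k.+1 (child m sg)) =
  riesz k (rep_pt k m) * (1 + q k (rep_pt k m) * sgn sg).
Proof.
have -> : rep_pt k.+1 (child m sg) = catd k (rep_pt k m) (rep_pt 1 (fun l => sg l : nat)).
  by rewrite -rep_pt_cat ?addn1 // => l; case: (sg l).
rewrite riesz_cat; congr (_ * (_ + _ * _)); apply: eq_bigr => l _.
by rewrite /rep_pt /= divn1 oddb.
Qed.

Lemma sum_sgn e : \sum_sg (1 + e * sgn sg) = (2 ^ d)%:R.
Proof.
rewrite big_split /= -mulr_sumr /sgn.
rewrite -(bigA_distr_bigA (fun _ (b : bool) => (-1) ^+ b)) /=.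
rewrite (bigD1 (Ordinal d_gt0)) //= big_bool /= expr0 expr1 addNr mul0r mulr0 addr0.
by rewrite sumr_const card_ffun card_bool card_ord.
Qed.

Lemma sgn_val sg : sgn sg = 1 \/ sgn sg = -1.
Proof.
rewrite /sgn; elim/big_ind: _ => [|a b|l _]; first by left.
  by case=> -> [] ->; rewrite ?mulrNN ?mulr1 ?mul1r; auto.
by case: (sg l); rewrite ?expr0 ?expr1; auto.
Qed.

(** A nonzero factor is 1 if [q k g] is 0 and 2 otherwise; this gives the equal splitting among the
    children that meet the set. *)
Lemma factor_eq k g sg sg' : 1 + q k g * sgn sg != 0 -> 1 + q k g * sgn sg' != 0 ->
  1 + q k g * sgn sg = 1 + q k g * sgn sg'.
Proof.
by case: (q_val k g) => ->; case: (sgn_val sg) => ->; case: (sgn_val sg') => ->;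
  rewrite ?mul0r ?mulr1 ?mulrN1 ?opprK ?subrr ?eqxx // addrC subrr eqxx.
Qed.

Lemma child_range k (m : midx d) sg : in_range k m -> in_range k.+1 (child m sg).
Proof. by move=> h l; move: (h l); rewrite /child expnS; case: (sg l); lia. Qed.

Lemma childP k (m : midx d) : in_range k.+1 m ->
  exists m' sg, in_range k m' /\ m = child m' sg.
Proof.
move=> h; exists (fun l => m l %/ 2)%N, [ffun l => odd (m l)]; split=> [l|].
  by rewrite ltn_divLR // -expnSr; apply: h.
by apply/funext => l; rewrite /child ffunE mulnC -modn2 -divn_eq.
Qed.

Lemma volS k : vol R d k.+1 = vol R d k / (2 ^ d)%:R.
Proof. by rewrite -addn1 volD /vol muln1. Qed.

Lemma pow2d_neq0 : (2 ^ d)%:R != 0 :> R.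
Proof. by rewrite pnatr_eq0 -lt0n expn_gt0. Qed.

Lemma riesz_tau_is_tauE : is_tauE riesz_set riesz_tau.
Proof.
have tau0 k m : riesz_tau k m = 0 <-> riesz k (rep_pt k m) = 0.
  rewrite /riesz_tau; split=> [/eqP|->]; last by rewrite mulr0.
  by rewrite mulf_eq0 (gt_eqF (vol_gt0 _ _ _)) => /eqP.
split.
- move=> k m hm; rewrite /riesz_tau.
  under eq_bigr do rewrite riesz_child.
  rewrite -mulr_sumr -mulr_sumr sum_sgn volS; field; exact: pow2d_neq0.
- by move=> k m _; rewrite mulr_ge0 ?riesz_ge0 // ltW // vol_gt0.
- by rewrite /riesz_tau /riesz big_ord0 /vol muln0 invr1 mulr1.
- move=> k m _; rewrite tau0 meets_rieszP; split=> [->|]; first by [].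
  by move/contrapT.
- move=> k m hm /meets_rieszP/eqP nz sg sg' /meets_rieszP/eqP + /meets_rieszP/eqP.
  rewrite /riesz_tau !riesz_child !mulf_eq0 (negbTE nz) /= => h h'.
  by rewrite (factor_eq h h').
Qed.

(** Induction on the rank: the mass of the parent and the equal splitting determine the masses of
    the children. *)
Lemma is_tauE_unique tau : is_tauE riesz_set tau ->
  forall k m, in_range k m -> tau k m = riesz_tau k m.
Proof.
move=> [hq _ h1 h0 he]; elim=> [|k IH] m hm.
  have -> : m = fun _ => 0%N by apply/funext => l; have := hm l; case: (m l).
  by rewrite h1 /riesz_tau /riesz big_ord0 /vol muln0 invr1 mulr1.
have [m' [sg [hm' ->]]] := childP hm.
have z s : riesz k.+1 (rep_pt k.+1 (child m' s)) = 0 -> tau k.+1 (child m' s) = 0.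
  by move=> e; apply/(h0 _ _ (child_range s hm')); rewrite meets_rieszP e.
case: (eqVneq (riesz k (rep_pt k m')) 0) => [e0|ne].
  by rewrite z /riesz_tau riesz_child e0 mul0r ?mulr0.
pose w s := 1 + q k (rep_pt k m') * sgn s.
have mw s : w s != 0 -> meets k.+1 (child m' s) riesz_set.
  by move=> ws; apply/meets_rieszP; rewrite riesz_child; apply/eqP; rewrite mulf_neq0.
have z' s : w s = 0 -> tau k.+1 (child m' s) = 0.
  by move=> ws; apply: z; rewrite riesz_child -/(w s) ws mulr0.
(* The weight [w] takes a single nonzero value, so the masses of the children are proportional to
   it; additivity then fixes [c], since the weights sum to [2 ^ d]. *)
have [c hc] : exists c, forall s, tau k.+1 (child m' s) = c * w s.
  case: (pickP (fun s => w s != 0)) => [s0 ws0|no].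
    exists (tau k.+1 (child m' s0) / w s0) => s.
    case: (eqVneq (w s) 0) => ws; first by rewrite z' // ws mulr0.
    have -> : w s = w s0 by exact: factor_eq.
    rewrite divfK //.
    by apply: (he k m' hm'); [apply/meets_rieszP/eqP | exact: mw | exact: mw].
  by exists 0 => s; rewrite mul0r z' //; apply/eqP; move: (no s) => /negbFE.
have := hq k m' hm'; under eq_bigr do rewrite hc.
rewrite -mulr_sumr sum_sgn hc IH // => e.
rewrite /riesz_tau riesz_child volS -/(w sg) in e *.
rewrite mulrA; congr (_ * _); apply: (mulIf pow2d_neq0).
by rewrite -e; field; exact: pow2d_neq0.
Qed.

End Riesz.

(** * Independence of partial sums from the indexing box *)

Section PartialSums.
Variables (R : realType) (d : nat).
Hypothesis d_gt0 : (0 < d)%N.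

Lemma sum_ffun_widen K K' (N : midx d) (F : midx d -> R) :
  (K <= K')%N -> (forall j, (N j <= K)%N) ->
  \sum_(n : {ffun 'I_d -> 'I_K'} | [forall j, (n j < N j)%N]) F (fun j => n j) =
  \sum_(n : {ffun 'I_d -> 'I_K} | [forall j, (n j < N j)%N]) F (fun j => n j).
Proof.
move=> KK' hN; case: K KK' hN => [|K] KK' hN.
  have F0 K0 (n : {ffun 'I_d -> 'I_K0}) : [forall j, (n j < N j)%N] = false.
    apply/negbTE/forallPn; exists (Ordinal d_gt0).
    by have := hN (Ordinal d_gt0); rewrite leqn0 => /eqP ->.
  by rewrite !big_pred0.
rewrite (reindex (fun n : {ffun 'I_d -> 'I_K.+1} => [ffun j => widen_ord KK' (n j)])) /=.
  apply: eq_big => n; first by apply: eq_forallb => j; rewrite ffunE.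
  by move=> _; congr F; apply/funext => j; rewrite ffunE.
exists (fun n : {ffun 'I_d -> 'I_K'} => [ffun j => inord (n j)]) => n.
  by move=> _; apply/ffunP => j; apply/val_inj; rewrite !ffunE /= inordK.
rewrite inE => /forallP h; apply/ffunP => j; apply/val_inj; rewrite !ffunE /= inordK //.
exact: leq_trans (h j) (hN j).
Qed.

Lemma psum_widen K (a : midx d -> R) (N : midx d) g : (forall j, (N j <= K)%N) ->
  psum a N g = \sum_(n : {ffun 'I_d -> 'I_K} | [forall j, (n j < N j)%N])
     a (fun j => n j) * Wd R (fun j => n j) g.
Proof.
move=> hN; pose F (n : midx d) := a n * Wd R n g.
have hb j : (N j <= bnd N)%N by rewrite /bnd (bigD1 j) //= leq_addr.
rewrite /psum -(@sum_ffun_widen _ (bnd N + K)%N N F) ?leq_addr //.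
by rewrite (@sum_ffun_widen K (bnd N + K)%N N F) // leq_addl.
Qed.

End PartialSums.

(** * Walsh coefficients of a Riesz product and their block structure *)

Section Coefficients.
Variables (R : realType) (d : nat) (q : nat -> pt d -> R).
Hypothesis d_gt0 : (0 < d)%N.
Hypothesis q_local : forall i (g g' : pt d),
  (forall l t, (t < i)%N -> g l t = g' l t) -> q i g = q i g'.
Variable tau : nat -> midx d -> R.
Hypothesis tauE : forall k m, in_range k m -> tau k m = riesz_tau q k m.
Implicit Types (x y g : pt d) (n N : midx d).

(** Raising the rank beyond the bits of [n] changes nothing: the test function ignores the new
    digit, so all [B] are 0. Any admissible rank can thus replace the one fixed in [tauhat]. *)
Lemma tauhat_avg k n : in_range k n ->
  tauhat tau n = avg k (fun x => riesz q k x * \prod_l W1 R (n l) (x l)).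
Proof.
set c := fun k => avg k (fun x => riesz q k x * \prod_l W1 R (n l) (x l)).
have step k' : in_range k' n -> c k'.+1 = c k'.
  move=> hk; rewrite /c (avg_rieszS q_local (phi := fun l => W1 R (n l))
    (A := fun l => W1 R (n l)) (B := fun l _ => 0)).
    apply: eq_avg => x; congr (_ * _).
    by rewrite [X in _ * X](bigD1 (Ordinal d_gt0)) //= mul0r mulr0 addr0.
  by move=> l x y; rewrite W1_cat modn_small // divn_small // W1_0 mulr1 mulr0 addr0.
have steps k' j : in_range k' n -> c (k' + j)%N = c k'.
  move=> hk; elim: j => [|j IH]; first by rewrite addn0.
  rewrite addnS step // => l; apply: leq_trans (hk l) _.
  by rewrite leq_exp2l // leq_addr.
set k0 := (\sum_j n j)%N.
have hk0 : in_range k0 n.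
  move=> l; apply: leq_ltn_trans (ltn_expl k0 _) => //.
  by rewrite /k0 (bigD1 l) //= leq_addr.
move=> hk; rewrite -[RHS](steps k k0) // addnC steps // /c /avg mulr_sumr.
apply: eq_bigr => m _; rewrite tauE; last by move=> l; apply: ltn_ord.
by rewrite /riesz_tau /Wk /Wd; ring.
Qed.

(** Let [K] be the position of the top bit of the largest component [n l']. In the integration of
    rank [K], the product of the [A] vanishes at [l'] and that of the [B] at [j], unless [n j]
    reaches [2 ^ K] too. *)
Lemma tauhat_same_block k j l n : tauhat tau n != 0 ->
  (n j < 2 ^ k)%N -> (n l < 2 ^ k)%N.
Proof.
move=> nz nj; rewrite ltnNge; apply/negP => nl; move/eqP: nz; apply.
case: (arg_maxnP n (i0 := l) (P := xpredT)) => // l' _ hmax.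
set K := trunc_log 2 (n l').
have nl' : (2 ^ k <= n l')%N by apply: leq_trans nl (hmax _ isT).
have pos : (0 < n l')%N by apply: leq_trans nl'; rewrite expn_gt0.
have /andP[K1 K2] := trunc_log_bounds (ltnSn 1) pos.
have kK : (k <= K)%N by rewrite /K -(@trunc_expnK 2 k) // leq_trunc_log.
rewrite (@tauhat_avg K.+1); last by move=> i; apply: leq_ltn_trans (hmax i isT) K2.
rewrite (avg_rieszS q_local (phi := fun l => W1 R (n l))
  (A := fun l (x : nat -> bool) => if (n l < 2 ^ K)%N then W1 R (n l) x else 0)
  (B := fun l (x : nat -> bool) =>
     if (n l < 2 ^ K)%N then 0 else W1 R (n l - 2 ^ K) x)); last first.
  by move=> i x y; apply: W1_split; apply: leq_ltn_trans (hmax i isT) K2.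
rewrite /avg big1 ?mulr0 // => m _.
rewrite (bigD1 l') //= ltnNge K1 /= mul0r add0r.
rewrite (bigD1 j) //= (leq_trans nj) ?leq_exp2l // mul0r !mulr0 //.
Qed.

Lemma psum_tauhat k N g : (forall j, (N j <= 2 ^ k)%N) ->
  psum (tauhat tau) N g =
  avg k (fun x => riesz q k x * \prod_l dker R (N l) (g l) (x l)).
Proof.
move=> hN; rewrite (psum_widen d_gt0 _ _ hN).
under eq_bigr => n _.
  rewrite (@tauhat_avg k) => [|l]; last exact: ltn_ord.
  rewrite mulrC -avgM; over.
rewrite -avg_sum; apply: eq_avg => x.
transitivity (riesz q k x * \sum_(n : {ffun 'I_d -> 'I_(2 ^ k)} | [forall j, (n j < N j)%N])
   \prod_l (W1 R (n l) (g l) * W1 R (n l) (x l))).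
  rewrite mulr_sumr; apply: eq_bigr => n _; rewrite /Wd big_split /=; ring.
congr (_ * _); under [RHS]eq_bigr => l _ do
  rewrite /dker (big_ord_widen (2 ^ k) (fun i => W1 R i (g l) * W1 R i (x l))) //.
rewrite bigA_distr_big_dep; apply: eq_bigl => n.
by apply/forallP/familyP => h l; apply: h.
Qed.

Lemma psum_block k N g j0 : (forall j, (2 ^ k <= N j)%N) -> (N j0 <= 2 ^ k.+1)%N ->
  psum (tauhat tau) N g = avg k (fun x => riesz q k x *
    (\prod_l dker R (2 ^ k) (g l) (x l) + q k x *
     \prod_l ((-1) ^+ g l k * dker R (minn (N l) (2 ^ k.+1) - 2 ^ k) (g l) (x l)))).
Proof.
move=> hN hj0; pose N' l := minn (N l) (2 ^ k.+1).
(* As [n j0 < 2 ^ k.+1], a nonzero coefficient has all its components below [2 ^ k.+1], so capping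
   [N] loses nothing. *)
have -> : psum (tauhat tau) N g = psum (tauhat tau) N' g.
  have hb j : (N j <= bnd N)%N by rewrite /bnd (bigD1 j) //= leq_addr.
  rewrite (psum_widen d_gt0 _ _ hb) (psum_widen (K := bnd N) d_gt0); last first.
    by move=> j; apply: leq_trans (geq_minl _ _) (hb j).
  rewrite big_mkcond [RHS]big_mkcond; apply: eq_bigr => n _.
  case: (eqVneq (tauhat tau (fun j => n j)) 0) => [->|nz]; first by rewrite mul0r !if_same.
  congr (if _ then _ else _); apply/forallP/forallP => h j; last first.
    by apply: leq_trans (h j) (geq_minl _ _).
  rewrite leq_min h /=; apply: (@tauhat_same_block k.+1 j0 j _ nz).
  exact: leq_trans (h j0) hj0.
rewrite (@psum_tauhat k.+1); last by move=> j; apply: geq_minr.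
rewrite (avg_rieszS q_local (phi := fun l => dker R (N' l) (g l))
  (A := fun l (x : nat -> bool) => dker R (2 ^ k) (g l) x)
  (B := fun l (x : nat -> bool) => (-1) ^+ g l k * dker R (N' l - 2 ^ k) (g l) x)) //.
move=> l x y.
have hN' : (N' l = 2 ^ k * 1 + (N' l - 2 ^ k))%N.
  by rewrite /N'; have := hN l; have : (2 ^ k <= 2 ^ k.+1)%N by [rewrite leq_exp2l]; lia.
have lowext r : (r <= 2 ^ k)%N -> dker R r (g l) (catp k x y) = dker R r (g l) x.
  move=> hr; apply: eq_bigr => i _; congr (_ * _); apply: (@W1_ext _ _ k).
    by apply: leq_trans (ltn_ord i) hr.
  by move=> t tk; rewrite catp_low.
have h : (N' l - 2 ^ k <= 2 ^ k)%N by rewrite /N' expnS; lia.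
rewrite [in LHS]hN' dker_block // muln1 !lowext // !W1_1 catp_high addn0; ring.
Qed.

Lemma riesz_disagree k g x : riesz q k g = 0 -> riesz q k x != 0 ->
  exists l t, (t < k)%N /\ g l t != x l t.
Proof.
move=> g0 xn; case: (boolP [forall l, [forall t : 'I_k, g l t == x l t]]) => [/forallP h|].
  case/eqP: xn; rewrite -g0; apply: riesz_local => // l t tk.
  by have /forallP/(_ (Ordinal tk))/eqP -> := h l.
by case/forallPn => l /forallPn [t ne]; exists l, t.
Qed.

(** The kernel product of order [2 ^ k] lives on the points agreeing with [g] in the first [k]
    digits, where the density is 0. *)
Lemma psum_block_zero k N g j0 : (forall j, (2 ^ k <= N j)%N) -> (N j0 <= 2 ^ k.+1)%N ->
  riesz q k g = 0 ->
  psum (tauhat tau) N g = avg k (fun x => riesz q k x * (q k x *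
     \prod_l ((-1) ^+ g l k * dker R (minn (N l) (2 ^ k.+1) - 2 ^ k) (g l) (x l)))).
Proof.
move=> hN hj0 g0; rewrite (psum_block _ hN hj0); apply: eq_avg => x.
case: (eqVneq (riesz q k x) 0) => [->|nx]; first by rewrite !mul0r.
have [l [t [tk ne]]] := riesz_disagree g0 nx.
by rewrite (bigD1 l) //= (dker_pow2_neq _ tk ne) mul0r add0r.
Qed.

Lemma tauhat_neq0 : tauhat tau (fun _ => 0%N) != 0.
Proof.
rewrite (@tauhat_avg 0) // /avg /vol muln0 invr1 mul1r.
under eq_bigr => m _ do rewrite /riesz big_ord0 mul1r.
under eq_bigr => m _ do under eq_bigr => l _ do rewrite W1_0.
under eq_bigr => m _ do rewrite big1_eq.
by rewrite sumr_const card_ffun !card_ord exp1n oner_eq0.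
Qed.

(** Components in a common dyadic block differ by at most a factor 2; this form of the block
    structure makes iterated sums finite. *)
Lemma tauhat_support j c n : tauhat tau n != 0 -> (n j <= 2 * n c)%N.
Proof.
move=> nz; case: (posnP (n c)) => [e|pos].
  have := @tauhat_same_block 0 c j n nz; rewrite e => /(_ isT); rewrite ltnS leqn0 => /eqP ->.
  by [].
have /andP[K1 K2] := trunc_log_bounds (ltnSn 1) pos.
have := tauhat_same_block j nz K2; rewrite expnS; lia.
Qed.

End Coefficients.

(** * Iterated summation of finitely supported fibers *)

Section IteratedSums.
Variables (R : realType) (d : nat) (f : midx d -> R).
Hypothesis d_gt0 : (0 < d)%N.
Hypothesis f_supp : forall n j c, f n != 0 -> (n j <= 2 * n c)%N.
Implicit Types (n : midx d) (cs : seq 'I_d).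

Definition fiber_sum K cs n : R :=
  \sum_(h : {ffun 'I_d -> 'I_K} | [forall j, (j \in cs) || (h j == n j :> nat)])
     f (fun j => h j).

Lemma fiber_sum_nil K n : (forall j, (n j < K)%N) -> fiber_sum K [::] n = f n.
Proof.
move=> hn; pose h0 : {ffun 'I_d -> 'I_K} := [ffun j => Ordinal (hn j)].
rewrite /fiber_sum (big_pred1 h0).
  by congr f; apply/funext => j; rewrite ffunE.
move=> h; apply/forallP/eqP => [e|-> j]; last by rewrite ffunE eqxx orbT.
by apply/ffunP => j; apply/val_inj; rewrite ffunE /=; apply/eqP; have := e j.
Qed.

Lemma fiber_sum_cons K c cs n : c \notin cs ->
  fiber_sum K (c :: cs) n = \sum_(v < K) fiber_sum K cs (upd n c v).
Proof.
move=> cn; rewrite /fiber_sum (partition_big (fun h : {ffun 'I_d -> 'I_K} => h c) xpredT) //=.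
apply: eq_bigr => v _; apply: eq_bigl => h; apply/andP/forallP.
  move=> [/forallP e /eqP hv] j; have := e j; rewrite in_cons /upd.
  by case: eqVneq => [->|] //=; rewrite hv eqxx orbT.
move=> e; split; last first.
  by have := e c; rewrite (negbTE cn) /upd eqxx.
by apply/forallP => j; have := e j; rewrite in_cons /upd; case: (eqVneq j c).
Qed.

(** The fixed coordinate [c0] bounds all others by [2 * n c0] on the support, so a larger box adds
    only zeros. *)
Lemma fiber_sum_widen K K' c0 cs n : (K <= K')%N -> c0 \notin cs -> (2 * n c0 < K)%N ->
  fiber_sum K' cs n = fiber_sum K cs n.
Proof.
move=> KK' c0n hK.
pose F (h : midx d) := if [forall j, (j \in cs) || (h j == n j)] then f h else 0.
have E K0 : fiber_sum K0 cs n = \sum_(h : {ffun 'I_d -> 'I_K0}) F (fun j => h j).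
  by rewrite /fiber_sum big_mkcond.
have := @sum_ffun_widen R d d_gt0 K K' (fun _ => K) F KK' (fun _ => leqnn K).
rewrite !E => e.
transitivity (\sum_(h : {ffun 'I_d -> 'I_K'} | [forall j, (h j < K)%N]) F (fun j => h j)).
  rewrite [RHS]big_mkcond; apply: eq_bigr => h _; case: ifPn => // /forallPn [j].
  rewrite -leqNgt => hj; rewrite /F; case: ifP => // /forallP hh.
  apply/eqP; apply: contraT => nz; have := f_supp j c0 nz.
  have := hh c0; rewrite (negbTE c0n) /= => /eqP ->; lia.
rewrite e; apply: eq_bigl => h; apply/forallP => j; exact: ltn_ord.
Qed.

Lemma iter_conv_fiber_sum K c0 cs n : uniq cs -> c0 \notin cs ->
  (forall j, j \notin cs -> (n j < K)%N) -> (2 * n c0 < K)%N ->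
  iter_conv f cs n (fiber_sum K cs n).
Proof.
elim: cs K n => [|c cs IH] K n.
  by move=> _ _ h _ /=; rewrite fiber_sum_nil // => j; apply: h.
move=> /= /andP[cn ucs]; rewrite in_cons negb_or => /andP[c0c c0n] hn hK.
have hu v : upd n c v c0 = n c0 by rewrite /upd (negbTE c0c).
(* The box has to contain the fixed value [v]. Values [v >= K] contribute 0, because the support
   forces [v <= 2 * n c0 < K]. *)
exists (fun v => fiber_sum (maxn K v.+1) cs (upd n c v)); split=> [v|].
  apply: IH => //; last by rewrite hu leq_max hK.
  move=> j jn; rewrite /upd leq_max; case: eqVneq => [_|jc]; first by rewrite ltnSn orbT.
  by rewrite hn // in_cons negb_or jc.
move=> e e0; exists K => M KM.
suff -> : \sum_(m < M) fiber_sum (maxn K m.+1) cs (upd n c m) = fiber_sum K (c :: cs) n.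
  by rewrite subrr normr0.
rewrite fiber_sum_cons // (big_ord_widen M (fun v => fiber_sum K cs (upd n c v))) //.
rewrite [RHS]big_mkcond; apply: eq_bigr => v _; case: ltnP => vK.
  by rewrite (maxn_idPl vK).
apply: big1 => h /forallP hh; apply/eqP; apply: contraT => nz.
have := f_supp c c0 nz; have := hh c0; have := hh c.
by rewrite (negbTE cn) (negbTE c0n) /= hu /upd eqxx => /eqP -> /eqP ->; lia.
Qed.

End IteratedSums.

Lemma conv_rect_cube (R : realType) d (a : midx d -> R) g S :
  conv_rect a g S -> conv_cube a g S.
Proof.
by move=> h e e0; have [K hK] := h e e0; exists K => N KN; apply: hK.
Qed.

(* The support condition makes all inner sums finite, so that the outer partial
   sums are rectangular ones. *)
Lemma conv_rect_rep (R : realType) d (a : midx d -> R) g S sg : (0 < d)%N ->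
  (forall n j c, a n != 0 -> (n j <= 2 * n c)%N) ->
  conv_rect a g S -> conv_rep sg a g S.
Proof.
move=> d_gt0 a_supp h; rewrite /conv_rep; set f := fun n => _.
have f_supp n j c : f n != 0 -> (n j <= 2 * n c)%N.
  by rewrite mulf_eq0 negb_or => /andP[/a_supp].
have : uniq [seq sg i | i <- enum 'I_d].
  by rewrite map_inj_uniq ?enum_uniq //; apply: perm_inj.
have : forall j, j \in [seq sg i | i <- enum 'I_d].
  by move=> j; apply/mapP; exists ((sg^-1)%g j); rewrite ?mem_enum ?permKV.
case: [seq sg i | i <- enum 'I_d] => [/(_ (Ordinal d_gt0))//|c0 cs] hall /= /andP[c0n ucs].
exists (fun v => fiber_sum f (2 * v).+1 cs (upd (fun _ => 0%N) c0 v)); split=> [v|].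
  apply: (iter_conv_fiber_sum d_gt0 f_supp ucs c0n); last by rewrite /upd eqxx.
  by move=> j jn; have := hall j; rewrite in_cons (negbTE jn) orbF /upd => ->; lia.
move=> e e0; have [K hK] := h e e0; exists K => M KM.
(* For an outer index below [M], the support keeps the other components below [(2 * M).+1], so this
   rectangle captures the outer partial sum exactly. *)
pose N : midx d := fun j => if j == c0 then M else (2 * M).+1.
suff -> : \sum_(v < M) fiber_sum f (2 * v).+1 cs (upd (fun _ => 0%N) c0 v) = psum a N g.
  by apply: hK => j; rewrite /N; case: eqP => _; lia.
rewrite (@psum_widen _ _ d_gt0 (2 * M).+1); last by move=> j; rewrite /N; case: eqP => _; lia.
rewrite (partition_big (fun h : {ffun 'I_d -> 'I_(2 * M).+1} => h c0)
  (fun v => v < M)%N) /=; last first.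
  by move=> n /forallP /(_ c0); rewrite /N eqxx.
transitivity (\sum_(v < M) fiber_sum f (2 * M).+1 cs (upd (fun _ => 0%N) c0 v)).
  apply: eq_bigr => v _; rewrite [RHS](fiber_sum_widen (K := (2 * v).+1) d_gt0 f_supp _ c0n) //.
    by rewrite ltnS leq_mul2l /= ltnW.
  by rewrite /upd eqxx.
rewrite (big_ord_widen (2 * M).+1
  (fun v => fiber_sum f (2 * M).+1 cs (upd (fun _ => 0%N) c0 v))); last by lia.
apply: eq_bigr => v vM; apply: eq_bigl => n; apply/forallP/andP => [hh|[_ /eqP <-] j].
  have e1 : n c0 = v by apply/val_inj/eqP; have := hh c0; rewrite (negbTE c0n) /upd eqxx.
  split; last exact/eqP.
  by apply/forallP => j; rewrite /N; case: eqP => [->|_]; rewrite ?e1.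
have := hall j; rewrite in_cons /upd; case: eqVneq => [-> _|_ /= -> //].
by rewrite eqxx orbT.
Qed.

(** * Sums of truncated kernels over a permuted family of blocks *)

Section BlockSums.
Variable R : realType.

Lemma sum_indic_le K (c : nat) (B : R) : 0 <= B ->
  \sum_(p < K) (if (p : nat) == c then B else 0) <= B.
Proof.
move=> B0; rewrite -big_mkcond /=; case: (ltnP c K) => cK.
  by rewrite (big_pred1 (Ordinal cK)).
rewrite big_pred0 // => p; apply/negbTE; rewrite neq_ltn.
by rewrite (leq_trans (ltn_ord p) cK).
Qed.

Variables (m N : nat) (s : {perm 'I_(2 ^ m)}) (g : nat -> bool).

Definition blk (p : 'I_(2 ^ m)) : R :=
  `|dker R (minn (2 ^ m) (N - 2 ^ m * s p)) g (rep1 m p)|.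

Let sum_perm_indic (B : R) : 0 <= B ->
  \sum_(p < 2 ^ m) (if (s p : nat) == (N %/ 2 ^ m)%N then B else 0) <= B.
Proof.
move=> B0; rewrite (reindex_inj (@perm_inj _ (s^-1)%g)) /=.
under eq_bigr do rewrite permKV.
exact: sum_indic_le.
Qed.

(** A block of [2 ^ m] frequencies other than the one with quotient [N %/ 2 ^ m] lies wholly below
    [N] or wholly at or above it. *)
Let blk_cases p : s p != (N %/ 2 ^ m)%N :> nat ->
  blk p = 0 \/ blk p = `|dker R (2 ^ m) g (rep1 m p)|.
Proof.
have M0 : (0 < 2 ^ m)%N by rewrite expn_gt0.
rewrite /blk neq_ltn => /orP[h|h].
  right; have : (2 ^ m * (s p).+1 <= N)%N by rewrite mulnC -leq_divRL.
  by rewrite mulnS => h'; rewrite (_ : minn _ _ = 2 ^ m)%N //; lia.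
left; have : (N < 2 ^ m * s p)%N by rewrite mulnC -ltn_divLR.
by move=> h'; rewrite (_ : minn _ _ = 0)%N ?/dker ?big_ord0 ?normr0 //; lia.
Qed.

(** At most two [p] contribute: the index of the digits of [g], where a full kernel survives, and
    the preimage under [s] of the cut block. *)
Lemma sum_blk_le : \sum_p blk p <= 2 * (2 ^ m)%:R.
Proof.
have P0 : 0 <= (2 ^ m)%:R :> R by [].
have le2 r (x : nat -> bool) : (r <= 2 ^ m)%N -> `|dker R r g x| <= (2 ^ m)%:R.
  by move=> hr; apply: le_trans (dker_norm _ _ _ _) _; rewrite ler_nat.
apply: (@le_trans _ _ (\sum_(p < 2 ^ m) (if (p : nat) == num m g then (2 ^ m)%:R else 0) +
   \sum_(p < 2 ^ m) (if (s p : nat) == (N %/ 2 ^ m)%N then (2 ^ m)%:R else 0))); last first.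
  by rewrite mulr_natl mulr2n lerD ?sum_indic_le ?sum_perm_indic.
rewrite -big_split /=; apply: ler_sum => p _.
case: (eqVneq (s p : nat) (N %/ 2 ^ m)%N) => [_|/blk_cases[->|->]].
- apply: (@le_trans _ _ (2 ^ m)%:R); first by rewrite le2 // geq_minl.
  by rewrite lerDr; case: ifP.
- by rewrite addr0; case: ifP.
rewrite addr0; case: eqP => [_|ne]; first exact: le2.
have [[t tm] /= ht] : exists t : 'I_m, g t != rep1 m p t.
  apply/existsP; apply: contraT; rewrite negb_exists => /forallP h; case: ne.
  rewrite -[LHS](num_rep1 (ltn_ord p)); apply: num_ext => t tm.
  by have := h (Ordinal tm); rewrite negbK => /eqP.
by rewrite (dker_pow2_neq _ tm ht) normr0.
Qed.

(** A disagreement with [g] kills the full kernels, so only the cut block remains, bounded through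
    [dker_norm_neq]. *)
Lemma sum_blk_neq_le k0 : (k0 <= m)%N ->
  \sum_(p < 2 ^ m) (if [exists t : 'I_k0, g t != rep1 m p t] then blk p else 0) <= (2 ^ k0)%:R.
Proof.
move=> k0m; apply: le_trans (sum_perm_indic (ler0n _ (2 ^ k0))).
apply: ler_sum => p _; case: ifP => [/existsP[[t tk] /= ht]|_]; last by case: ifP.
case: eqVneq => [_|/blk_cases[->|->]] //; first exact: dker_norm_neq tk ht.
by rewrite (dker_pow2_neq _ (leq_trans tk k0m) ht) normr0.
Qed.

End BlockSums.

(** * Growth of the sequence of ranks *)

Lemma msqS t : msq t.+1 = (4 * msq t + 2)%N.
Proof. by rewrite /=; lia. Qed.

Lemma msq_lt t t' : (t < t')%N -> (4 * msq t + 2 <= msq t')%N.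
Proof.
elim: t' => // t' IH; rewrite ltnS leq_eqVlt msqS => /orP[/eqP->//|/IH]; lia.
Qed.

Lemma leq_msq t : (2 * t <= msq t)%N.
Proof. by elim: t => // t; rewrite msqS; lia. Qed.

(** * The set of the theorem as the nonvanishing set of a Riesz product *)

Section Fpi.
Variables (R : realType) (d : nat).
Variable pis : forall t : nat, 'I_d -> {perm 'I_(2 ^ msq t)}.
Implicit Types (g x y : pt d).

Definition numo k (x : nat -> bool) : 'I_(2 ^ k) := Ordinal (num_lt k x).

(* The value W^(m_s)_{pi_s(m) m'} prescribed to R_{2 m_s 1} in the definition of
   F_s on the cube containing g. *)
Definition Qpi t g : R :=
  \prod_l W1 R (pis t l (numo (msq t) (g l))) (fun k => g l (msq t + k)%N).

(* At most one term of the sum is present, and none unless i = 2 m_s. *)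
Definition qpi i g : R := \sum_(t < i.+1 | (2 * msq t == i)%N) Qpi t g.

Lemma msq_inj t t' : (2 * msq t = 2 * msq t')%N -> t = t'.
Proof. by move=> e; case: (ltngtP t t') => // /msq_lt; lia. Qed.

Lemma qpi_special t g : qpi (2 * msq t) g = Qpi t g.
Proof.
have ht : (t < (2 * msq t).+1)%N by have := leq_msq t; lia.
rewrite /qpi (big_pred1 (Ordinal ht)) // => t' /=.
by apply/eqP/eqP => [/msq_inj e|->//]; apply/val_inj.
Qed.

Lemma qpi_0 i g : (forall t, (2 * msq t)%N <> i) -> qpi i g = 0.
Proof. by move=> h; rewrite /qpi big_pred0 // => t; apply/eqP. Qed.

Lemma specialP i : (exists t, i = (2 * msq t)%N) \/ (forall g, qpi i g = 0).
Proof.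
case: (pselect (exists t, i = (2 * msq t)%N)) => [|h]; first by left.
by right=> g; apply: qpi_0 => t e; apply: h; exists t.
Qed.

Lemma Qpi_val t g : Qpi t g = 1 \/ Qpi t g = -1.
Proof.
rewrite /Qpi; elim/big_ind: _ => [|a b|l _]; first by left.
  by case=> -> [] ->; rewrite ?mulrNN ?mulr1 ?mul1r; auto.
rewrite /W1 -signr_odd; case: (odd _); rewrite ?expr0 ?expr1; auto.
Qed.

Lemma qpi_val i g : [\/ qpi i g = 0, qpi i g = 1 | qpi i g = -1].
Proof.
case: (specialP i) => [[t ->]|->]; last by constructor 1.
by rewrite qpi_special; case: (Qpi_val t g) => ->; [constructor 2 | constructor 3].
Qed.

Lemma Qpi_local t g g' : (forall l i, (i < 2 * msq t)%N -> g l i = g' l i) ->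
  Qpi t g = Qpi t g'.
Proof.
move=> h; apply: eq_bigr => l _.
have -> : numo (msq t) (g l) = numo (msq t) (g' l).
  by apply/val_inj/num_ext => i hi; apply: h; lia.
by apply: (W1_ext _ (k := msq t)) => // i hi; apply: h; lia.
Qed.

Lemma qpi_local i g g' : (forall l t, (t < i)%N -> g l t = g' l t) ->
  qpi i g = qpi i g'.
Proof.
case: (specialP i) => [[t ->]|h0 _]; last by rewrite !h0.
by rewrite !qpi_special; apply: Qpi_local.
Qed.

Lemma Qpi_cat t x y :
  Qpi t (catd (msq t) x y) = \prod_l W1 R (pis t l (numo (msq t) (x l))) (y l).
Proof.
apply: eq_bigr => l _; congr W1; last by apply/funext => k; rewrite /catd catp_high.
by congr (nat_of_ord (pis t l _)); apply/val_inj/num_ext => i hi; rewrite /catd catp_low.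
Qed.

(** The indices [m] and [m'] are determined by the first [2 * msq t] digits of [g]: its head and its
    tail of length [msq t]. *)
Lemma FsP t g : Fs R pis t g <-> Rk R (2 * msq t) g = Qpi t g.
Proof.
have cubeP (m m' : {ffun 'I_d -> 'I_(2 ^ msq t)}) :
    in_cube (2 * msq t) (fun l => 2 ^ msq t * m l + m' l)%N g <->
    forall l i, (i < 2 * msq t)%N -> g l i =
      catd (msq t) (rep_pt (msq t) (fun l => m l)) (rep_pt (msq t) (fun l => m' l)) l i.
  rewrite in_cubeP (_ : 2 * msq t = msq t + msq t)%N; last by lia.
  by rewrite rep_pt_cat // => l; apply: ltn_ord.
split=> [[m [m' [/cubeP hc ->]]]|e].
  rewrite (Qpi_local hc) Qpi_cat; apply: eq_bigr => l _; congr W1.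
  by congr (nat_of_ord (pis t l _)); apply/val_inj; rewrite /= num_rep1.
pose m : {ffun 'I_d -> 'I_(2 ^ msq t)} := [ffun l => numo (msq t) (g l)].
pose m' : {ffun 'I_d -> 'I_(2 ^ msq t)} :=
  [ffun l => numo (msq t) (fun k => g l (msq t + k)%N)].
have hc l i : (i < 2 * msq t)%N -> g l i =
    catd (msq t) (rep_pt (msq t) (fun l => m l)) (rep_pt (msq t) (fun l => m' l)) l i.
  move=> hi; rewrite /catd /catp; case: ltnP => h.
    by rewrite -[LHS](rep1_num _ h) /rep_pt /m ffunE.
  rewrite -[in LHS](subnKC h) -[LHS](@rep1_num (msq t) (fun k => g l (msq t + k)%N)); last by lia.
  by rewrite /rep_pt /m' ffunE.
exists m, m'; split; first exact/cubeP.
rewrite e (Qpi_local hc) Qpi_cat; apply: eq_bigr => l _; congr W1.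
by congr (nat_of_ord (pis t l _)); apply/val_inj; rewrite /= num_rep1.
Qed.

(** For signs, [R = Q] holds exactly when [1 + R * Q] is nonzero; at the other ranks the factor is
    1. *)
Lemma FpiE : Fpi R pis = riesz_set qpi.
Proof.
apply/funext => g; apply/propext; split=> [h i|h t].
  case: (specialP i) => [[t ->]|->]; last by rewrite mulr0 addr0 oner_eq0.
  have /FsP := h t; rewrite qpi_special => ->.
  by case: (Qpi_val t g) => ->; rewrite ?mulrNN mulr1 (_ : 1 + 1 = 2%:R) // pnatr_eq0.
apply/FsP; have := h (2 * msq t)%N; rewrite qpi_special.
by case: (Qpi_val t g) => ->; case: (Rk_val R (2 * msq t) g) => ->;
  rewrite ?mulr1 ?mulrN1 ?mulN1r ?subrr ?eqxx.
Qed.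

Lemma riesz_const a b g : (a <= b)%N ->
  (forall i, (a <= i < b)%N -> qpi i g = 0) -> riesz qpi b g = riesz qpi a g.
Proof.
move=> ab h; rewrite /riesz -!(big_mkord xpredT (fun i => 1 + Rk R i g * qpi i g)).
rewrite (big_cat_nat (n := a)) //= [X in _ * X]big_nat_cond [X in _ * X]big1 ?mulr1 // => i.
by rewrite andbT => /h ->; rewrite mulr0 addr0.
Qed.

Lemma qpi_between t i g : (msq t <= i < msq t.+1)%N -> i != (2 * msq t)%N ->
  qpi i g = 0.
Proof.
move=> hi /eqP ne; apply: qpi_0 => t' e; apply: ne; rewrite -e.
case: (ltngtP t t') => [|/msq_lt|->//]; last by lia.
rewrite leq_eqVlt => /orP[/eqP|/msq_lt]; last by rewrite -/(msq t.+1); lia.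
by move=> e'; rewrite -e' in e; lia.
Qed.

Lemma riesz_double t g : riesz qpi (2 * msq t) g = riesz qpi (msq t) g.
Proof.
apply: riesz_const => [|i hi]; first by lia.
apply: (@qpi_between t); last by lia.
by rewrite msqS; lia.
Qed.

(** Only the [t] ranks [2 * msq t'] with [t' < t] lie below [msq t], and each factor is at most
    2. *)
Lemma riesz_msq_le t g : riesz qpi (msq t) g <= (2 ^ t)%:R.
Proof.
elim: t => [|t IH]; first by rewrite /riesz big_ord0.
rewrite (@riesz_const (2 * msq t).+1) => [|| i hi]; first last.
- by apply: (@qpi_between t); lia.
- by rewrite msqS; lia.
rewrite rieszS riesz_double expnSr natrM; apply: ler_pM => //.
- exact: riesz_ge0 qpi_val _ _.
- exact: factor_ge0 qpi_val _ _.
by case: (Rk_val R (2 * msq t) g) => ->; case: (qpi_val (2 * msq t) g) => ->; lra.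
Qed.

End Fpi.

(** * Estimate of the partial sums off the set, and convergence *)

Section Estimate.
Variables (R : realType) (d : nat).
Hypothesis d_gt0 : (0 < d)%N.
Variable pis : forall t : nat, 'I_d -> {perm 'I_(2 ^ msq t)}.
Implicit Types (g x y : pt d).
Local Notation q := (@qpi R d pis).

Lemma numo_rep1 k (p : 'I_(2 ^ k)) : numo k (rep1 k p) = p.
Proof. by apply/val_inj; rewrite /= num_rep1. Qed.

Lemma riesz_eq0_leq k k' g : (k <= k')%N -> riesz q k g = 0 -> riesz q k' g = 0.
Proof.
by move=> kk' /eqP/prodf_eq0 [i _ /eqP e]; apply: riesz_eq0 e; apply: leq_trans kk'.
Qed.

(** No special rank lies in [[msq t, 2 * msq t)], so the density ignores the second half of the
    digits, and [avg_W1_dker] integrates them out with [c] the permuted index. *)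
Lemma block_average t (N : midx d) g (s : 'I_d -> R) :
  (forall l, (N l <= 2 ^ (msq t + msq t))%N) ->
  avg (msq t + msq t) (fun x => riesz q (2 * msq t) x * (q (2 * msq t) x *
    \prod_l (s l * dker R (N l) (g l) (x l)))) =
  avg (msq t) (fun x => riesz q (msq t) x * \prod_l (s l *
    W1 R (pis t l (numo (msq t) (x l))) (fun k => g l (msq t + k)%N) *
    dker R (minn (2 ^ msq t) (N l - 2 ^ msq t * pis t l (numo (msq t) (x l)))) (g l) (x l))).
Proof.
move=> hN; rewrite avgD; apply: eq_avg => x.
transitivity (avg (msq t) (fun y => riesz q (msq t) x * \prod_l
   (W1 R (pis t l (numo (msq t) (x l))) (y l) *
     (s l * dker R (N l) (g l) (catp (msq t) (x l) (y l)))))).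
  apply: eq_avg => y; rewrite riesz_double qpi_special Qpi_cat -big_split /=.
  congr (_ * _); apply: riesz_local; first exact: qpi_local.
  by move=> l i hi; rewrite /catd catp_low.
rewrite avgM; congr (_ * _).
rewrite (avg_prod _ (fun l z => W1 R (pis t l (numo (msq t) (x l))) z *
   (s l * dker R (N l) (g l) (catp (msq t) (x l) z)))).
apply: eq_bigr => l _; under eq_bigr do rewrite mulrCA.
rewrite -mulr_sumr avg_W1_dker //; field.
by rewrite pnatr_eq0 -lt0n expn_gt0.
Qed.

Lemma block_estimate t k0 (N : midx d) g (s : 'I_d -> R) :
  riesz q k0 g = 0 -> (k0 <= msq t)%N -> (forall l, `|s l| = 1) ->
  (forall l, (N l <= 2 ^ (msq t + msq t))%N) ->
  `|avg (msq t + msq t) (fun x => riesz q (2 * msq t) x * (q (2 * msq t) x *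
    \prod_l (s l * dker R (N l) (g l) (x l))))| <=
  (2 ^ t)%:R * (d%:R * ((2 ^ k0)%:R / (2 ^ msq t)%:R * 2 ^+ d.-1)).
Proof.
move=> g0 k0m s1 hN; rewrite block_average //; set m := msq t in k0m *.
pose u l (z : nat -> bool) : R :=
  `|dker R (minn (2 ^ m) (N l - 2 ^ m * pis t l (numo m z))) (g l) z|.
(* Where the density is nonzero, [x] differs from [g] early in some coordinate. Summing over that
   coordinate [l] and recording the disagreement only there keeps each summand a product, so
   averages factor. *)
pose w (l l' : 'I_d) (z : nat -> bool) : R := if l' == l then
  (if [exists i : 'I_k0, g l' i != z i] then u l' z else 0) else u l' z.
have w0 l l' z : 0 <= w l l' z by rewrite /w /u; do 2?case: ifP => // _.
have uE l (p : 'I_(2 ^ m)) : u l (rep1 m p) = blk R (N l) (pis t l) (g l) p.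
  by rewrite /u numo_rep1.
have invm : 0 < (2 ^ m)%:R^-1 :> R by rewrite invr_gt0 ltr0n expn_gt0.
apply: le_trans (avg_norm _ _) _.
apply: (@le_trans _ _ (avg m (fun x => (2 ^ t)%:R * \sum_l \prod_l' w l l' (x l')))).
  apply: le_avg => x; rewrite normrM ger0_norm ?(riesz_ge0 (@qpi_val _ _ _)) // normr_prod.
  under eq_bigr do rewrite !normrM s1 W1_norm !mul1r -/(u _ _).
  case: (eqVneq (riesz q m x) 0) => [->|nz].
    by rewrite mul0r mulr_ge0 // sumr_ge0 // => l _; apply: prodr_ge0.
  apply: ler_pM; rewrite ?(riesz_ge0 (@qpi_val _ _ _)) ?riesz_msq_le ?prodr_ge0 //.
    by move=> l _; apply: normr_ge0.
  have nz0 : riesz q k0 x != 0 by apply: contraNneq nz => /(riesz_eq0_leq k0m) ->.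
  have [l [i [ik ne]]] := riesz_disagree (@qpi_local _ _ _) g0 nz0.
  rewrite [leRHS](bigD1 l) //=; apply: le_trans (_ : \prod_l' w l l' (x l') <= _).
    apply: ler_prod => l' _; rewrite normr_ge0 /w; case: eqP => //= ->.
    by rewrite ifT //; apply/existsP; exists (Ordinal ik).
  by rewrite lerDl sumr_ge0 // => j _; apply: prodr_ge0.
rewrite avgM ler_wpM2l // avg_sum.
apply: (@le_trans _ _ (\sum_(l : 'I_d) ((2 ^ k0)%:R / (2 ^ m)%:R * 2 ^+ d.-1))); last first.
  by rewrite sumr_const card_ord [d%:R * _]mulr_natl lexx.
apply: ler_sum => l _; rewrite (avg_prod _ (w l)).
rewrite (bigD1 l) //=; apply: ler_pM.
- by rewrite mulr_ge0 ?sumr_ge0 // ltW.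
- by apply: prodr_ge0 => l' _; rewrite mulr_ge0 ?sumr_ge0 // ltW.
- rewrite mulrC ler_pM2r // /w eqxx.
  under eq_bigr do rewrite uE.
  exact: sum_blk_neq_le.
rewrite (_ : d.-1 = #|[pred l' | l' != l]|); last by rewrite -[in LHS](card_ord d) (cardC1 l).
rewrite -prodr_const; apply: ler_prod => l' /negbTE ne.
rewrite mulr_ge0 ?sumr_ge0 ?(ltW invm) //= /w ne.
under eq_bigr do rewrite uE.
by rewrite ler_pdivrMl ?ltr0n ?expn_gt0 // mulrC sum_blk_le.
Qed.

Variable tau : nat -> midx d -> R.
Hypothesis tauE : forall k m, in_range k m -> tau k m = riesz_tau q k m.

Lemma conv_rect_tauhat g : ~ Fpi R pis g -> conv_rect (tauhat tau) g 0.
Proof.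
rewrite FpiE => /existsNP [i /negP]; rewrite negbK => /eqP gi e e0.
pose k0 := i.+1; have gk0 : riesz q k0 g = 0 by apply: riesz_eq0 gi.
pose C : R := d%:R * (2 ^ k0)%:R * 2 ^+ d.-1.
have C0 : 0 <= C by rewrite !mulr_ge0 // exprn_ge0.
(* The first term ensures [k0 <= msq T]; the second makes [C / 2 ^ t < e] from [T] on. *)
pose T := maxn k0 (Num.bound (C / e)).
have hT t : (T <= t)%N -> C < e * (2 ^ t)%:R.
  move=> Tt; rewrite mulrC -ltr_pdivrMr //.
  have : C / e < (Num.bound (C / e))%:R by apply: archi_boundP; rewrite divr_ge0 // ltW.
  move=> /lt_trans; apply; rewrite ltr_nat.
  by apply: leq_ltn_trans (ltn_expl t (ltnSn 1)); apply: leq_trans Tt; apply: leq_maxr.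
(* The smallest component then lies in a dyadic block of rank [k >= 2 * msq T]; so the density of
   rank [k] vanishes at [g], and [k = 2 * msq t] forces [t >= T]. *)
exists (2 ^ (2 * msq T))%N => N hN; rewrite subr0.
case: (arg_minnP N (i0 := Ordinal d_gt0) (P := xpredT)) => // j0 _ hmin.
have Nj0 : (0 < N j0)%N by apply: leq_trans (hN j0); rewrite expn_gt0.
set k := trunc_log 2 (N j0).
have /andP[K1 K2] := trunc_log_bounds (ltnSn 1) Nj0.
have hk : (2 * msq T <= k)%N by rewrite /k -(@trunc_expnK 2 (2 * msq T)) // leq_trunc_log.
have hNk j : (2 ^ k <= N j)%N by apply: leq_trans K1 (hmin j isT).
have k0T : (k0 <= msq T)%N by have := leq_msq T; have : (k0 <= T)%N := leq_maxl _ _; lia.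
have gk : riesz q k g = 0 by apply: riesz_eq0_leq gk0; lia.
rewrite (psum_block_zero d_gt0 (@qpi_local R d pis) tauE hNk (ltnW K2) gk).
case: (specialP R pis k) => [[t ek]|q0]; last first.
  by rewrite /avg big1 ?mulr0 ?normr0 // => x _; rewrite q0 mul0r mulr0.
have Tt : (T <= t)%N.
  by rewrite leqNgt; apply/negP => /msq_lt; rewrite ek in hk; lia.
have mTt : (msq T <= msq t)%N by rewrite ek in hk; lia.
have kmm : k = (msq t + msq t)%N by lia.
have := @block_estimate t k0 (fun l => minn (N l) (2 ^ k.+1) - 2 ^ k)%N g
  (fun l => (-1) ^+ g l k) gk0 (leq_trans k0T mTt).
rewrite -kmm -ek => /(_ _ _)/le_lt_trans; apply.
- by move=> l; rewrite normrX normrN1 expr1n.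
- by move=> l; have := geq_minr (N l) (2 ^ k.+1); rewrite expnS; lia.
have P0 j : 0 < (2 ^ j)%:R :> R by rewrite ltr0n expn_gt0.
apply: (@le_lt_trans _ _ (C / (2 ^ t)%:R)); last by rewrite ltr_pdivrMr // hT.
rewrite ler_pdivlMr //.
(* What remains is [2 ^ t * 2 ^ t <= 2 ^ msq t], which follows from [leq_msq]. *)
have -> : (2 ^ t)%:R * (d%:R * ((2 ^ k0)%:R / (2 ^ msq t)%:R * 2 ^+ d.-1)) * (2 ^ t)%:R =
    C * ((2 ^ t)%:R * (2 ^ t)%:R) / (2 ^ msq t)%:R by rewrite /C; ring.
rewrite ler_pdivrMr // ler_wpM2l // -natrM ler_nat -expnD leq_exp2l //.
by have := leq_msq t; lia.
Qed.

End Estimate.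

(** * Null-series for the three modes of convergence *)

Lemma null_series_tauhat (R : realType) d (pis : forall t : nat, 'I_d -> {perm 'I_(2 ^ msq t)})
    (tau : nat -> midx d -> R) : (0 < d)%N -> is_tauE (Fpi R pis) tau ->
  [/\ null_series_for (@conv_rect R d) (tauhat tau) (Fpi R pis),
      null_series_for (@conv_cube R d) (tauhat tau) (Fpi R pis) &
      forall sg : {perm 'I_d},
        null_series_for (@conv_rep R d sg) (tauhat tau) (Fpi R pis)].
Proof.
move=> d_gt0 htau.
have tauE : forall k m, in_range k m -> tau k m = riesz_tau (@qpi R d pis) k m.
  apply: is_tauE_unique => //; [exact: qpi_local | exact: qpi_val | by rewrite -FpiE].
have nz : exists n, tauhat tau n != 0.
  by exists (fun _ => 0%N); apply: tauhat_neq0 (@qpi_local R d pis) _ tauE.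
have conv := conv_rect_tauhat d_gt0 tauE.
split=> [||sg]; split=> // g /conv; first exact: conv_rect_cube.
apply: conv_rect_rep => // n j c.
exact: tauhat_support (@qpi_local R d pis) _ tauE _ _ _.
Qed.

Theorem theorem2 (R : realType) (d : nat) (hd : (2 <= d)%N)
    (pis : forall t : nat, 'I_d -> {perm 'I_(2 ^ msq t)}) :
  [/\ Mset (@conv_rect R d) (Fpi R pis),
      Mset (@conv_cube R d) (Fpi R pis),
      (forall sg : {perm 'I_d}, Mset (@conv_rep R d sg) (Fpi R pis)),
      (exists tau : nat -> midx d -> R, is_tauE (Fpi R pis) tau) &
      (forall tau : nat -> midx d -> R, is_tauE (Fpi R pis) tau ->
         [/\ null_series_for (@conv_rect R d) (tauhat tau) (Fpi R pis),
             null_series_for (@conv_cube R d) (tauhat tau) (Fpi R pis) &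
             forall sg : {perm 'I_d},
               null_series_for (@conv_rep R d sg) (tauhat tau) (Fpi R pis)])].
Proof.
have d_gt0 : (0 < d)%N by apply: ltnW.
have null tau := @null_series_tauhat R d pis tau d_gt0.
(* The Riesz masses serve both as the existing quasimeasure and, through their coefficients, as the
   witness for all three [Mset] claims. *)
have htau : is_tauE (Fpi R pis) (riesz_tau (@qpi R d pis)).
  by rewrite FpiE; apply: riesz_tau_is_tauE; [|exact: qpi_local|exact: qpi_val].
have [h1 h2 h3] := null _ htau.
by split=> //; [exists (tauhat (riesz_tau (@qpi R d pis)))..|
  exists (riesz_tau (@qpi R d pis))].
Qed.
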